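(* Let $\mathcal{G}$ be a family of finite groups of bounded exponent (there is a constant $m$ such that every $G\in\mathcal{G}$ has exponent at most $m$), each of which is a $p$-group for some prime $p$ (which may depend on the group). Suppose that at least one of the following holds: (1) the groups in $\mathcal{G}$ have $p$-degrees of bounded variance: there is a constant $M$ such that for every nontrivial $G\in\mathcal{G}$ with $p$-degrees $r$, $\mathrm{Var}(X_r)\le M$; (2) the groups in $\mathcal{G}$ have $p$-degrees of linear expectation: there is a constant $c>0$ such that for every nontrivial $G\in\mathcal{G}$ with $p$-degrees $r=(r_1,\dots,r_\ell)$, $\mathbb{E}(X_r)\ge\ell/c$. Then STPP constructions in the family $\mathcal{G}$ cannot achieve $\omega=2$; that is, there is a real number $\tau$ with $2<\tau\le 3$ such that for every $G\in\mathcal{G}$ and every STPP construction $(S_i,T_i,U_i)_i$ in $G$, $$\sum_i (|S_i||T_i||U_i|)^{\tau/3}\le \sum_j d_j^{\tau},$$ where the $d_j$ are the dimensions of the irreducible complex representations of $G$.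
   Context: STPP constructions. An STPP construction in a finite group $G$ is a finite collection of triples of subsets $S_i,T_i,U_i\subseteq G$ satisfying the simultaneous triple product property: (1) for each $i$ and all $s,s'\in S_i$, $t,t'\in T_i$, $u,u'\in U_i$, if $s^{-1}s't^{-1}t'u^{-1}u'=1$ then $s=s'$, $t=t'$, $u=u'$; (2) for all $i,j,k$ and all $s\in S_i$, $s'\in S_j$, $t\in T_j$, $t'\in T_k$, $u\in U_k$, $u'\in U_i$, if $s^{-1}s't^{-1}t'u^{-1}u'=1$ then $i=j=k$. It is known that every STPP construction satisfies $\sum_i(|S_i||T_i||U_i|)^{\omega/3}\le\sum_j d_j^{\omega}$, where $\omega$ is the exponent of matrix multiplication and the $d_j$ are the dimensions of the irreducible complex representations of $G$. ''STPP constructions in a family cannot achieve $\omega=2$'' means that these inequalities, for all STPP constructions in groups of the family, do not imply $\omega=2$: some real $\tau\in(2,3]$ in place of $\omega$ is consistent with all of them. $p$-degrees. For a finite $p$-group $G$ the $p$-lower central series is defined by $\Gamma_1=G$ and $\Gamma_i=[G,\Gamma_{i-1}]\,\Gamma_{\lceil i/p\rceil}^{(p)}$ for $i\ge2$, where for a subgroup $H$, $H^{(p)}$ is the subgroup generated by $\{h^p:h\in H\}$. The quotients $\Gamma_j/\Gamma_{j+1}$ are $\mathbb{F}_p$-vector spaces. The length $\ell$ is the minimal $\ell$ with $\Gamma_{\ell+1}=1$. The $p$-degrees of $G$ are $r=(r_1,\dots,r_\ell)$ with $r_j=\dim_{\mathbb{F}_p}\Gamma_j/\Gamma_{j+1}$;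 if $|G|=p^n$ then $\sum_j r_j=n$. For $n\ge 1$, $X_r$ denotes the random variable taking value $i\in\{1,\dots,\ell\}$ with probability $r_i/n$. *)

(* Defs.v *)
From HB Require Import structures.
From mathcomp Require Import all_boot all_order all_algebra all_fingroup.
From mathcomp Require Import all_solvable all_field all_character.
From mathcomp Require Import all_classical all_reals all_analysis.
From mathcomp Require Import zify.

Set Implicit Arguments.
Unset Strict Implicit.
Unset Printing Implicit Defensive.

Import Order.TTheory GRing.Theory Num.Theory.

Local Open Scope group_scope.

Section STPP.
Variables (gT : finGroupType) (G : {group gT}) (I : finType).
Variables (S T U : I -> {set gT}).

Definition STPP : Prop :=
  [/\ forall i, [/\ S i \subset G, T i \subset G & U i \subset G],
      forall i s s' t t' u u',
        s \in S i -> s' \in S i -> t \in T i -> t' \in T i ->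
        u \in U i -> u' \in U i ->
        s^-1 * s' * t^-1 * t' * u^-1 * u' = 1 ->
        [/\ s = s', t = t' & u = u']
    & forall i j k s s' t t' u u',
        s \in S i -> s' \in S j -> t \in T j -> t' \in T k ->
        u \in U k -> u' \in U i ->
        s^-1 * s' * t^-1 * t' * u^-1 * u' = 1 ->
        i = j /\ j = k].

End STPP.

Section PLowerCentralSeries.
Variables (p : nat) (gT : finGroupType).
Implicit Types G H : {group gT}.

Definition pth_powers H : {group gT} := <<[set h ^+ p | h in H]>>%G.

Definition ceil_div (i d : nat) : nat := ((i + d.-1) %/ d)%N.

(* The p-lower central series. The recursion is course-of-values, hence the fuel
   argument; [plcs] starts at index 1, with the dummy value [plcs G 0 = G], and
   satisfies the defining recurrence by [plcs1] and [plcsE] below. *)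
Fixpoint plcs_rec (fuel : nat) G (i : nat) : {group gT} :=
  if fuel is f.+1 then
    if (i <= 1)%N then G
    else ([~: G, plcs_rec f G i.-1] <*>
           pth_powers (plcs_rec f G (ceil_div i p)))%G
  else G.

Definition plcs G (i : nat) : {group gT} := plcs_rec i G i.

(* The search bound loses nothing for a p-group: see [plengthP]. *)
Definition plength G : nat :=
  find (fun l => plcs G l.+1 :==: 1) (iota 0 #|G|).

(* For a p-group the quotient is elementary abelian ([plcs_abelem]), so the
   p-logarithm of its order is its dimension over 'F_p. Entry j of the sequence
   (counting from 0) is r_(j+1). *)
Definition pdegrees G : seq nat :=
  mkseq (fun j => logn p #|plcs G j.+1 / plcs G j.+2|) (plength G).

End PLowerCentralSeries.

Section RandomDegree.
Local Open Scope ring_scope.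
Variables (R : realType) (r : seq nat).

Definition degree_mass (j : nat) : {nonneg R} := (nth 0%N r j)%:R%:nng.

(* The law of X_r on nat: mass r_i at each i in {1, ..., size r}, normalized to
   total mass 1 (for p-degrees the sum of the r_i is n by [sumn_pdegrees]). If
   all r_i are 0 it is the Dirac mass at 0. *)
Definition degree_law : probability nat R :=
  mnormalize (msum (fun j => mscale (degree_mass j) (dirac j.+1)) (size r))
             (dirac 0%N).

Definition degree_rv : nat -> R := fun i => i%:R.

End RandomDegree.

(* The irreducible representations are over algC; the irreducible complex
   representations have the same dimensions, being defined over algC. *)
Definition irr_dim (gT : finGroupType) (G : {group gT}) (j : Iirr G) : nat :=
  irr_degree (socle_of_Iirr j).

Section PLowerCentralSeriesTheory.
Variables (p : nat) (gT : finGroupType).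
Implicit Types G H : {group gT}.

Lemma ceil_div_leP i d m : (0 < d)%N -> (ceil_div i d <= m)%N = (i <= m * d)%N.
Proof. by move=> d0; rewrite /ceil_div -ltnS ltn_divLR // mulSn; lia. Qed.

Lemma ceil_div_lt i : (1 < p)%N -> (1 < i)%N -> (ceil_div i p < i)%N.
Proof.
move=> p1 i1; rewrite /ceil_div ltn_divLR; last by lia.
nia.
Qed.

Lemma ceil_div_gt0 i : (0 < p)%N -> (0 < i)%N -> (0 < ceil_div i p)%N.
Proof. by move=> p0 i0; rewrite /ceil_div divn_gt0 //; lia. Qed.

Lemma ceil_div_le i j : (i <= j)%N -> (ceil_div i p <= ceil_div j p)%N.
Proof. by move=> ij; rewrite /ceil_div leq_div2r // leq_add2r. Qed.

Lemma plcs_rec_fuel f f' G i : (1 < p)%N -> (i <= f)%N -> (i <= f')%N ->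
  plcs_rec p f G i = plcs_rec p f' G i.
Proof.
move=> p1; elim: f f' i => [|f IH] [|f'] i //=.
- by rewrite leqn0 => /eqP->.
- by move=> _; rewrite leqn0 => /eqP->.
move=> if_ if'; case: leqP => // i1.
have c := ceil_div_lt p1 i1.
by rewrite (IH f' i.-1) ?(IH f' (ceil_div i p)) //; lia.
Qed.

Lemma plcs1 G : plcs p G 1 = G.
Proof. by []. Qed.

Lemma plcs_join G i : (1 < p)%N -> (1 < i)%N ->
  plcs p G i =
    ([~: G, plcs p G i.-1] <*> pth_powers p (plcs p G (ceil_div i p)))%G.
Proof.
move=> p1 i1; have c := ceil_div_lt p1 i1.
case: i i1 c => [|i] //= i1; rewrite ltnS => c.
rewrite {1}/plcs /= leqNgt i1 /= -/(plcs p G i).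
by rewrite [plcs_rec _ _ _ (ceil_div _ _)](plcs_rec_fuel _ p1 c (leqnn _)).
Qed.

Lemma pth_powersS H (K : {group gT}) : H \subset K -> pth_powers p H \subset pth_powers p K.
Proof. by move=> HK; apply: genS; apply: imsetS. Qed.

Lemma pth_powers_sub H : pth_powers p H \subset H.
Proof.
by rewrite gen_subG; apply/fintype.subsetP => _ /imsetP[h hH ->]; rewrite groupX.
Qed.

Lemma pth_powers_norm G H : G \subset 'N(H) -> G \subset 'N(pth_powers p H).
Proof.
move=> nHG; apply/fintype.subsetP => g gG; rewrite inE /= -genJ genS //.
apply/fintype.subsetP => _ /imsetP[_ /imsetP[h hH ->] ->].
by apply/imsetP; exists (h ^ g); rewrite ?conjXg // memJ_norm // (fintype.subsetP nHG).
Qed.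

Lemma plcs_normal G i : (1 < p)%N -> normal (plcs p G i) G.
Proof.
move=> p1; elim/ltn_ind: i => i IH.
case: (leqP i 1) => [|i1]; first by case: i {IH} => [|[|]] // _; apply: normal_refl.
have /andP[s1 n1] := IH i.-1 ltac:(lia).
have /andP[s2 n2] := IH _ (ceil_div_lt p1 i1).
rewrite plcs_join // /normal join_subG commg_subl (fintype.subset_trans s1 (normG G)).
rewrite (fintype.subset_trans (pth_powers_sub _)) //=.
by rewrite normsY ?pth_powers_norm // normsR // normG.
Qed.

Lemma plcsE G i : (1 < p)%N -> (1 < i)%N ->
  plcs p G i =
    [~: G, plcs p G i.-1] * pth_powers p (plcs p G (ceil_div i p)) :> {set gT}.
Proof.
move=> p1 i1; rewrite plcs_join //= norm_joinEr //.
have /andP[s n] := plcs_normal G (ceil_div i p) p1.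
have /andP[s' n'] := plcs_normal G i.-1 p1.
apply: fintype.subset_trans (fintype.subset_trans (pth_powers_sub _) s) _.
by rewrite normsR // normG.
Qed.

Lemma plcs_leS G i : (1 < p)%N -> plcs p G i.+1 \subset plcs p G i.
Proof.
move=> p1; elim/ltn_ind: i => i IH.
case: (leqP i 1) => [i1|i1].
  have -> : plcs p G i = G by case: i i1 {IH} => [|[|]].
  by case/andP: (plcs_normal G i.+1 p1).
have anti a b : (a <= b)%N -> (b <= i)%N -> plcs p G b \subset plcs p G a.
  move=> ab; elim: b ab => [|b IHb]; first by rewrite leqn0 => /eqP->.
  rewrite leq_eqVlt ltnS => /predU1P[-> //|ab] bi.
  by rewrite (fintype.subset_trans (IH b bi)) // IHb // ltnW.
rewrite (plcs_join G p1 (leqW i1)) /=.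
have E := plcs_join G p1 i1; rewrite [X in _ \subset pred_of_set (gval X)]E /=.
rewrite genS // finset.setUSS //.
  by rewrite commgS //; apply: anti; lia.
apply: pth_powersS; apply: anti; first by rewrite ceil_div_le.
by have := ceil_div_lt p1 (ltnW i1 : 1 < i.+1)%N; rewrite ltnS.
Qed.

Lemma plcs_anti G i j : (1 < p)%N -> (i <= j)%N -> plcs p G j \subset plcs p G i.
Proof.
move=> p1 ij; rewrite -(subnKC ij); elim: (j - i)%N => [|k IH]; rewrite ?addn0 //.
by rewrite addnS (fintype.subset_trans (plcs_leS _ _ p1)).
Qed.

Lemma plcs_abelem G i : prime p -> p.-group G -> (0 < i)%N ->
  p.-abelem (plcs p G i / plcs p G i.+1).
Proof.
move=> pp pG i0; have p1 := prime_gt1 pp.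
have /andP[sG nG] := plcs_normal G i p1.
have /andP[sG' nG'] := plcs_normal G i.+1 p1.
have sub := fintype.subset_trans sG nG'.
rewrite abelemE //; apply/andP; split.
  apply: sub_der1_abelian; rewrite [plcs p G i.+1]plcs_join //=.
  by rewrite /derg1 (fintype.subset_trans _ (joing_subl _ _)) // commSg.
apply/exponentP => _ /morphimP[x nx xi ->].
rewrite -morphX //; apply: coset_id.
rewrite [plcs p G i.+1]plcs_join //=.
apply: (fintype.subsetP (joing_subr _ _)); apply: mem_gen; apply/imsetP; exists x => //.
by apply: fintype.subsetP xi; apply: plcs_anti => //; rewrite -ltnS ceil_div_lt.
Qed.

(* If the series is constant from i to p * i, then H = Gamma_i satisfies
   H = [G, H] H^(p), which forces H = 1 in a p-group. *)
Lemma plcs_stable G i : prime p -> p.-group G -> (0 < i)%N ->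
  plcs p G (p * i) :=: plcs p G i -> plcs p G i :=: 1.
Proof.
move=> pp pG i0 E; have p1 := prime_gt1 pp.
have pi1 : (1 < p * i)%N by nia.
have Ec : ceil_div (p * i) p = i.
  rewrite /ceil_div mulnC divnMDl ?prime_gt0 // divn_small ?addn0 //.
  by rewrite prednK // prime_gt0.
have Ep : plcs p G (p * i).-1 :=: plcs p G i.
  apply/eqP; rewrite finset.eqEsubset plcs_anti ?(@plcs_anti G i) //=; last by nia.
  by rewrite -{1}E plcs_anti // leq_pred.
have := plcs_join G p1 pi1; rewrite Ec => /(congr1 (@gval gT)) /=.
rewrite E Ep; set H := plcs p G i => EH.
have /andP[sH nH] : normal H G by apply: plcs_normal.
have pH : p.-group H := pgroupS sH pG.
have sR : [~: G, H] \subset H by rewrite commg_subr.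
have sP : pth_powers p H \subset 'Phi(H).
  rewrite (Phi_joing pH) gen_subG; apply/fintype.subsetP => _ /imsetP[h hH ->].
  apply: (fintype.subsetP (joing_subr _ _)).
  by rewrite -[p in h ^+ p]expn1; apply: Mho_p_elt (mem_p_elt pH hH).
have /Phi_nongen : 'Phi(H) <*> [~: G, H] = H.
  apply/eqP; rewrite finset.eqEsubset join_subG Phi_sub sR /=.
  by rewrite {1}EH joingC genS // finset.setUSS.
rewrite genGid => ER; apply/eqP; apply/negPn/negP => nt.
have : [~: H, G] \proper H.
  by apply: (nil_comm_properl (pgroup_nil pG)) => //; rewrite finset.subsetI subxx.
by rewrite commGC ER fintype.properxx.
Qed.

Lemma plcs_trivial G : prime p -> p.-group G -> plcs p G #|G| :=: 1.
Proof.
move=> pp pG; have p1 := prime_gt1 pp.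
have pK i : p.-group (plcs p G i).
  by apply: pgroupS pG; case/andP: (plcs_normal G i p1).
have key k : (logn p #|plcs p G (p ^ k)| <= logn p #|G| - k)%N.
  elim: k => [|k IH]; first by rewrite subn0 expn0.
  have pk : (0 < p ^ k)%N by rewrite expn_gt0 prime_gt0.
  rewrite expnS.
  case: (eqVneq (gval (plcs p G (p * p ^ k)%N)) (plcs p G (p ^ k))) => [E|nE].
    by rewrite E (plcs_stable pp pG pk E) cards1 logn1.
  have : plcs p G (p * p ^ k)%N \proper plcs p G (p ^ k)%N.
    rewrite finset.properEneq nE plcs_anti // leq_pmull // prime_gt0 //.
  move=> /proper_card; rewrite (card_pgroup (pK _)) (card_pgroup (pK (p ^ k)%N)).
  rewrite ltn_exp2l // => lt.
  by rewrite pfactorK //; lia.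
have := key (logn p #|G|); rewrite subnn leqn0 -(card_pgroup pG) => /eqP l0.
by apply/eqP; rewrite trivg_card1 (card_pgroup (pK _)) l0.
Qed.

Lemma plengthP G : prime p -> p.-group G ->
  plcs p G (plength p G).+1 :=: 1 /\
  forall l, plcs p G l.+1 :=: 1 -> (plength p G <= l)%N.
Proof.
move=> pp pG.
have h : has (fun l => plcs p G l.+1 :==: 1) (iota 0 #|G|).
  apply/hasP; exists #|G|.-1; first by rewrite mem_iota add0n prednK ?leqnn.
  by apply/eqP; rewrite prednK // plcs_trivial.
have lt : (plength p G < #|G|)%N by rewrite -[X in (_ < X)%N](size_iota 0) -has_find.
split; first by have /eqP := nth_find 0%N h; rewrite -/(plength p G) nth_iota.
move=> l E; rewrite leqNgt; apply/negP => ll.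
have := before_find 0%N ll; rewrite nth_iota ?add0n ?E ?eqxx //.
exact: ltn_trans lt.
Qed.

Lemma sumn_pdegrees G : prime p -> p.-group G ->
  sumn (pdegrees p G) = logn p #|G|.
Proof.
move=> pp pG; have p1 := prime_gt1 pp.
have H k : (sumn (mkseq (fun j => logn p #|plcs p G j.+1 / plcs p G j.+2|) k)
    + logn p #|plcs p G k.+1|)%N = logn p #|G|.
  elim: k => [|k IH]; first by rewrite plcs1.
  rewrite -IH mkseqS sumn_rcons -addnA; congr addn.
  rewrite -lognM ?cardG_gt0 // card_quotient.
    by rewrite mulnC Lagrange // plcs_leS.
  have /andP[s1 _] := plcs_normal G k.+1 p1.
  by have /andP[_ n2] := plcs_normal G k.+2 p1; apply: fintype.subset_trans s1 n2.
have [E _] := plengthP pp pG.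
by rewrite -(H (plength p G)) E cards1 logn1 addn0.
Qed.

End PLowerCentralSeriesTheory.

Section RandomDegreeTheory.
Local Open Scope ring_scope.

Lemma mnormalizeE d (T : measurableType d) (R : realType)
    (mu : {measure set T -> \bar R}) (P : probability T R) (k : R) A :
  (0 < k)%R -> mu classical_sets.setT = k%:E ->
  mnormalize mu P A = (mu A * (k^-1)%:E)%E.
Proof. by move=> k0 muT; rewrite /mnormalize muT eqe gt_eqF. Qed.

Variables (R : realType) (r : seq nat).
Hypothesis r_gt0 : (0 < sumn r)%N.

Let n : R := (sumn r)%:R.

Lemma degree_law_integral (f : nat -> R) : (forall i, 0 <= f i) ->
  (\int[degree_law R r]_w (f w)%:E)%E =
    (\sum_(j < size r) f j.+1 * ((nth 0%N r j)%:R / n))%:E.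
Proof.
move=> f0.
have n0 : 0 < n by rewrite ltr0n.
pose mu := msum (fun j => mscale (degree_mass R r j) (@dirac _ nat j.+1 R)) (size r).
have muT : mu classical_sets.setT = n%:E.
  rewrite /mu /msum /= /mscale /= (eq_bigr (fun j : 'I__ => (nth 0%N r j)%:R%:E)).
    by rewrite sumEFin -natr_sum /n sumnE [in RHS](big_nth 0%N) big_mkord.
  by move=> j _; rewrite diracT mule1.
have k0 : 0 <= n^-1 by rewrite invr_ge0 ltW.
rewrite (eq_measure_integral (mscale (NngNum k0) mu)); last first.
  move=> A _ _; apply: (eq_trans (mnormalizeE _ _ n0 muT)); exact: muleC.
rewrite ge0_integral_mscale //=; last by move=> i _; rewrite lee_fin.
rewrite ge0_integral_measure_sum //=; last by move=> i _; rewrite lee_fin.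
rewrite -sumEFin ge0_sume_distrr; last first.
  by move=> i _; apply: integral_ge0 => x _; rewrite lee_fin.
apply: eq_bigr => j _.
rewrite ge0_integral_mscale //=; last by move=> i _; rewrite lee_fin.
by rewrite integral_dirac //= diracT mul1e -!EFinM mulrC -mulrA mulrCA.
Qed.

Lemma degree_expectation :
  expectation (degree_law R r) (degree_rv R) =
    (\sum_(j < size r) j.+1%:R * ((nth 0%N r j)%:R / n))%:E.
Proof. by rewrite unlock degree_law_integral // => i; exact: ler0n. Qed.

Lemma degree_variance (mu := \sum_(j < size r) j.+1%:R * ((nth 0%N r j)%:R / n)) :
  variance (degree_law R r) (degree_rv R) =
    (\sum_(j < size r) (j.+1%:R - mu) ^+ 2 * ((nth 0%N r j)%:R / n))%:E.
Proof.
rewrite /variance unlock degree_expectation unlock.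
rewrite -(degree_law_integral (f := fun i => (i%:R - mu) ^+ 2)) // => i.
exact: sqr_ge0.
Qed.

End RandomDegreeTheory.

(* Main.v *)
(* Let n = log_p |G|, let w range over the weights (the index i taken r_i times),
   let A, B be the sums of the w and of the w^2, and D = (p-1) A. By Jennings, F_p[G]
   is spanned by monomials, with generating function P(t) = prod_w (1 + t^w + ... +
   t^((p-1)w)), any three of which have product 0 when their weights add up to more
   than D. An STPP construction embeds a direct sum of matrix multiplication tensors
   in the multiplication of F_p[G]. The support of that sum is tight, so triangular
   elimination assigns distinct monomials to the variables in each of the three sets
   such that the weights of a supported triple add up to at most D. By AM-GM over
   the support, sum_i (|S_i||T_i||U_i|)^(2/3) <= P(t) t^(-D/3) for 0 < t <= 1. A
   Hoeffding-type choice of t bounds the right side by p^n exp(-A^2 / (36 B)). Either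
   hypothesis gives A^2 >= kap n B with kap > 0 uniform, and bounded exponent bounds p,
   hence the sum is at most |G|^(1 - delta) with delta uniform. This leaves room for
   some tau > 2, because sum_j d_j^tau >= |G|. *)
Require Import Defs.
From HB Require Import structures.
From mathcomp Require Import all_boot all_order all_algebra all_fingroup.
From mathcomp Require Import all_solvable all_field all_character.
From mathcomp Require Import all_classical all_reals all_analysis.
From mathcomp Require Import ring lra zify.

Set Implicit Arguments.
Unset Strict Implicit.
Unset Printing Implicit Defensive.

Import Order.TTheory GRing.Theory Num.Theory.

Local Open Scope ring_scope.

(** * The p-lower central series satisfies [Gamma_i, Gamma_j] <= Gamma_{i+j} *)

Section CommutatorWithPower.
Local Open Scope group_scope.
Import FiniteModule.
Variable gT : finGroupType.

(** In additive notation this is d^k y, where 1 + d is conjugation by x. *)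
Fixpoint iter_comm (x y : gT) k := if k is l.+1 then [~ iter_comm x y l, x] else y.

(** Conjugation by x multiplies each iterated commutator by the next one, so it acts as 1 + d with d
    the shift; the formula is the binomial expansion of (1 + d)^m. The group V need not be stable
    under x, so membership is carried along in the induction. *)
Lemma conjg_expg_iter_comm (V : {group gT}) (abV : abelian V) (x y : gT) :
  (forall k, iter_comm x y k \in V) ->
  forall m k, iter_comm x y k ^ (x ^+ m) \in V /\
    fmod abV (iter_comm x y k ^ (x ^+ m)) =
    (\sum_(l < m.+1) fmod abV (iter_comm x y (k + l)) *+ 'C(m, l))%R.
Proof.
move=> yV; elim=> [|m IH] k.
  by rewrite conjg1 yV big_ord1 addn0 bin0 mulr1n.
have E : iter_comm x y k ^ x ^+ m.+1 =
    iter_comm x y k ^ x ^+ m * iter_comm x y k.+1 ^ x ^+ m.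
  by rewrite expgS conjgM -conjMg /= -conjg_mulR.
have [m1 e1] := IH k; have [m2 e2] := IH k.+1.
rewrite E groupM //; split=> //; rewrite fmodM // e1 e2.
rewrite big_ord_recl [in X in (_ + X)%R]big_ord_recr /=.
rewrite [RHS]big_ord_recl [in RHS]big_ord_recr /= !bin0 !binn -!addrA; congr (_ + _)%R.
rewrite addrA; congr (_ + _)%R; last by rewrite /bump leq0n add1n addnS.
rewrite -big_split /=; apply: eq_bigr => i _.
by rewrite /bump leq0n !add1n binS mulrnDr addnS.
Qed.

(** In (1 + d)^p y the middle binomial coefficients are divisible by p and d y, d^2 y, ... are
    killed by p, while d^p y is trivial; only y remains. *)
Lemma conjg_expp_iter_comm (p : nat) (V : {group gT}) (x y : gT) :
  prime p -> abelian V -> (forall k, iter_comm x y k \in V) ->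
  (forall k, iter_comm x y k.+1 ^+ p = 1) -> iter_comm x y p = 1 ->
  y ^ (x ^+ p) = y.
Proof.
move=> pp abV yV yp1 yp.
have [m1 e1] := conjg_expg_iter_comm abV yV p 0.
have f1 : fmod abV 1 = 0%R by rewrite fmod1.
apply: (can_in_inj (fmodK abV)) => //; first exact: (yV 0%N).
rewrite e1 big_ord_recl /= bin0 mulr1n big1 ?addr0 // => i _.
rewrite /bump leq0n add1n -/(iter_comm x y i.+1).
have [->|ni] := eqVneq i.+1 p; first by rewrite yp f1 mul0rn.
have /dvdnP[q ->] : (p %| 'C(p, i.+1))%N by apply: prime_dvd_bin => //; have := ltn_ord i; lia.
by rewrite mulnC mulrnA -fmodX ?yV // yp1 f1 mul0rn.
Qed.

End CommutatorWithPower.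

Section PLowerCentralSeriesIsNpSeries.
Local Open Scope group_scope.
Variables (p : nat) (gT : finGroupType) (G : {group gT}).
Hypothesis p_prime : prime p.
Let p1 : (1 < p)%N := prime_gt1 p_prime.
Local Notation Gam := (plcs p G).

Lemma plcs_sub i : Gam i \subset G.
Proof. exact: normal_sub (plcs_normal _ _ p1). Qed.

Lemma plcs_norm i : G \subset 'N(Gam i).
Proof. exact: normal_norm (plcs_normal _ _ p1). Qed.

Lemma plcs_expp i x : x \in Gam i -> x ^+ p \in Gam (p * i)%N.
Proof.
case: (posnP i) => [->|i0] xi.
  by rewrite muln0 groupX.
rewrite plcs_join //; last by nia.
have -> : ceil_div (p * i) p = i.
  by rewrite /ceil_div mulnC divnMDl ?prime_gt0 // divn_small ?addn0 // prednK ?prime_gt0.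
by apply: (fintype.subsetP (joing_subr _ _)); apply/mem_gen/imsetP; exists x.
Qed.

Lemma plcs_comm1 j : [~: G, Gam j] \subset Gam j.+1.
Proof.
case: j => [|j]; first exact: comm_subG.
by rewrite [in X in _ \subset X]plcs_join //= joing_subl.
Qed.

Lemma plcs_comm i j : [~: Gam i, Gam j] \subset Gam (i + j)%N.
Proof.
suff main : forall i j, (i <= j)%N -> [~: Gam i, Gam j] \subset Gam (i + j)%N.
  case: (leqP i j) => [/main //|/ltnW/main].
  by rewrite commGC addnC.
move=> {}i; elim/ltn_ind: i => i IHle {}j ij.
have IH k l : (k < i)%N -> [~: Gam k, Gam l] \subset Gam (k + l)%N.
  move=> ki; case: (leqP k l) => [|/ltnW] kl; first exact: IHle.
  by rewrite commGC addnC; apply: IHle => //; apply: leq_ltn_trans ki.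
case: (leqP i 1) => [|i1].
  case: i ij {IHle IH} => [|[|//]] ij _; last exact: plcs_comm1.
  by rewrite add0n commg_subr plcs_norm.
set N := Gam (i + j)%N.
have nN : G \subset 'N(N) := plcs_norm _.
have nNk k : Gam k \subset 'N(N) := fintype.subset_trans (plcs_sub k) nN.
rewrite -quotient_cents2 // sub_quotient_pre //.
have anti k l : (l <= k)%N -> Gam k \subset Gam l by apply: plcs_anti.
(* The two factors in the recursive description of [Gam i] are treated separately. For the
   commutator factor, the three subgroup lemma modulo [N] reduces to commutators with [Gam i.-1],
   covered by induction. *)
rewrite [X in pred_of_set (gval X) \subset _]plcs_join //= join_subG; apply/andP; split.
  rewrite -sub_quotient_pre; last by rewrite comm_subG.
  apply/commG1P; rewrite quotientR //.
  apply: three_subgroup.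
    rewrite -!quotientR //; last by rewrite comm_subG.
    apply/trivgP; rewrite quotient_sub1; last by rewrite !comm_subG.
    apply: (fintype.subset_trans (commSg _ (IH i.-1 j _))); first by lia.
    rewrite commGC; apply: (fintype.subset_trans (plcs_comm1 _)).
    by apply: anti; lia.
  rewrite -!quotientR //; last by rewrite comm_subG.
  apply/trivgP; rewrite quotient_sub1; last by rewrite !comm_subG.
  rewrite [[~: Gam j, G]]commGC.
  apply: (fintype.subset_trans (commSg _ (plcs_comm1 j))).
  rewrite commGC; apply: (fintype.subset_trans (IH i.-1 j.+1 _)); first by lia.
  by apply: anti; lia.
(* For x of weight a, y of weight j: modulo N the group <y> Gamma_{j+a} is abelian
   and x acts on it as 1 + d, so x^p acts as 1 + d^p + p(...), which fixes y. *)
set a := ceil_div i p.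
have ai : (a < i)%N by apply: ceil_div_lt.
have a0 : (0 < a)%N by apply: ceil_div_gt0; lia.
have iap : (i <= a * p)%N by rewrite -ceil_div_leP ?prime_gt0.
rewrite gen_subG; apply/fintype.subsetP => _ /imsetP[x xa ->].
have xN : x \in 'N(N) := fintype.subsetP (nNk a) x xa.
apply/morphpreP; split; first by rewrite groupX.
rewrite morphX //=; apply/centP => _ /morphimP[y yN yj ->].
apply/commute_sym/commgP/conjg_fixP.
set xb := coset N x; set yb := coset N y.
have Wj k : iter_comm xb yb k \in Gam (j + k * a)%N / N.
  elim: k => [|k IHk] /=; first by rewrite addn0 mem_quotient.
  apply: (fintype.subsetP _ _ (mem_commg IHk (mem_quotient N xa))).
  rewrite -quotientR // quotientS // commGC.
  by apply: (fintype.subset_trans (IH a _ ai)); apply: anti; lia.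
have W1 k : iter_comm xb yb k.+1 \in Gam (j + a)%N / N.
  by apply: (fintype.subsetP _ _ (Wj k.+1)); apply/quotientS/anti; nia.
(* The weight is redistributed: [Gam j] lies in [Gam (i - a)], and i - a < i puts its commutator
   with [Gam (j + a)] under the induction hypothesis, with total weight i + j. *)
have cN (A : {set gT}) : A \subset Gam j -> Gam (j + a)%N / N \subset 'C(A / N).
  move=> sA; rewrite quotient_cents2 ?(fintype.subset_trans sA) //.
  have E : (i - a + (j + a) = i + j)%N by lia.
  rewrite /N -E commGC; apply: fintype.subset_trans (IH (i - a)%N (j + a)%N _); last by lia.
  by apply: commSg; apply: fintype.subset_trans sA (anti _ _ _); lia.
have abV : abelian (<[yb]> <*> (Gam (j + a)%N / N)).
  rewrite abelianY cycle_abelian /= {1}/abelian cN; last by apply: anti; lia.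
  by rewrite -quotient_cycle // cN ?cycle_subG.
apply: (conjg_expp_iter_comm (V := (<[yb]> <*> (Gam (j + a)%N / N))%G) p_prime abV).
- case=> [|k]; first by rewrite mem_gen // inE cycle_id.
  by rewrite mem_gen // inE W1 orbT.
- move=> k; have /morphimP[z zN zi ->] := W1 k.
  rewrite -morphX //; apply: coset_id.
  by apply: (fintype.subsetP _ _ (plcs_expp zi)); apply: anti; nia.
have : iter_comm xb yb p \in N / N.
  by apply: (fintype.subsetP _ _ (Wj p)); apply/quotientS/anti; nia.
by rewrite trivg_quotient => /set1P.
Qed.
End PLowerCentralSeriesIsNpSeries.

(** * Jennings' theorem *)

Section PpowerFiltration.
Variables (p : nat) (gT : finGroupType) (A : pzRingType) (rho : gT -> A).
Hypotheses (p_prime : prime p) (charA : p%:R = 0 :> A).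
Hypotheses (rho1 : rho 1%g = 1) (rhoM : {morph rho : x y / (x * y)%g >-> x * y}).
Implicit Types F : nat -> {group gT}.

(* The span of the products of factors h - 1, with h of weight i, whose total
   weight is at least d. *)
Inductive ifil F : nat -> A -> Prop :=
| ifil0 d : ifil F d 0
| ifil1 : ifil F 0 1
| ifilD d a b : ifil F d a -> ifil F d b -> ifil F d (a + b)
| ifilN d a : ifil F d a -> ifil F d (- a)
| ifilMh d i a h : ifil F d a -> h \in F i -> ifil F (d + i) (a * (rho h - 1))
| ifil_weaken d e a : (e <= d)%N -> ifil F d a -> ifil F e a.

Lemma ifilM F d e a b : ifil F d a -> ifil F e b -> ifil F (d + e) (a * b).
Proof.
move=> fa; elim=> [{}e||{}e u v _ hu _ hv|{}e u _ hu|{}e i u h _ hu hi|e' {}e u le _ hu].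
- by rewrite mulr0; apply: ifil0.
- by rewrite mulr1 addn0.
- by rewrite mulrDr; apply: ifilD.
- by rewrite mulrN; apply: ifilN.
- by rewrite mulrA addnA; apply: ifilMh.
- by apply: ifil_weaken hu; rewrite leq_add2l.
Qed.

Lemma ifil_h F i h : h \in F i -> ifil F i (rho h - 1).
Proof. by move=> hi; have := ifilMh (ifil1 F) hi; rewrite mul1r. Qed.

Lemma rhoX h n : rho (h ^+ n)%g = rho h ^+ n.
Proof. by elim: n => [|n IH]; rewrite ?expg0 ?expr0 // expgS exprS rhoM IH. Qed.

(** The binomial formula applies because a - 1 commutes with 1. Expanding (a - 1) + 1 rather than a
    - 1 avoids the sign (-1)^p. *)
Lemma frobenius_sub1 (a : A) : (a - 1) ^+ p = a ^+ p - 1.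
Proof.
have E : (a - 1 + 1) ^+ p = (a - 1) ^+ p + 1.
  rewrite exprDn_comm; last exact: commr1.
  case: p p_prime charA => // q qp cA.
  rewrite big_ord_recl big_ord_recr /= big1 ?add0r; last first.
    move=> i _; rewrite /bump leq0n add1n expr1n mulr1.
    have /dvdnP[k ->] : (q.+1 %| 'C(q.+1, i.+1))%N.
      by apply: prime_dvd_bin => //; have := ltn_ord i; lia.
    by rewrite -mulr_natr natrM cA mulr0 mulr0.
  by rewrite /bump leq0n add1n bin0 binn !mulr1n subn0 subnn !expr1n expr0 !mulr1.
by rewrite -[in RHS](subrK 1 a) E addrK.
Qed.

(** These are the N_p-series of Lazard. Jennings' theorem is proved at this generality because its
    induction passes to the traces of F on a maximal subgroup H, which need not form the p-lower
    central series of H. *)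
Record np_series F : Prop := NpSeries {
  np_anti : forall i, F i.+1 \subset F i;
  np_comm : forall i j, [~: F i, F j]%g \subset F (i + j)%N;
  np_expp : forall i x, x \in F i -> (x ^+ p)%g \in F (p * i)%N }.

Lemma np_antiW F i j : np_series F -> (i <= j)%N -> F j \subset F i.
Proof.
move=> nF ij; rewrite -(subnKC ij); elim: (j - i)%N => [|k IH]; rewrite ?addn0 //.
by rewrite addnS; apply: fintype.subset_trans (np_anti nF _) IH.
Qed.

Lemma np_norm F i : np_series F -> F 0%N \subset 'N(F i)%g.
Proof. by move=> nF; rewrite -commg_subr; apply: np_comm. Qed.

Lemma np_series_cap F (H0 : {group gT}) :
  np_series F -> np_series (fun i => (F i :&: H0 : {set gT}))%G.
Proof.
move=> nF; split=> [i|i j|i x] /=.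
- by rewrite finset.setSI ?np_anti.
- rewrite finset.subsetI.
  rewrite (fintype.subset_trans _ (np_comm nF i j)) ?commgSS ?finset.subsetIl //=.
  by rewrite comm_subG ?finset.subsetIr.
by move=> /setIP[xi xH]; rewrite inE np_expp ?groupX.
Qed.

(* H contains everything of weight above the minimal weight w, and has index p.
   The claim I_d(G) = sum_{e<p} I_{d-ew}(H) (g - 1)^e reduces G to H. *)
Section Step.
Variables (F : nat -> {group gT}) (H : {group gT}) (w : nat) (g : gT).
Hypotheses (nF : np_series F).
Let K i := (F i :&: H)%G.
Hypotheses (Fw : F w :=: F 0%N) (FH : F w.+1 \subset H) (nH : F 0%N \subset 'N(H)%g).
Hypotheses (gF : g \in F 0%N) (gpH : (g ^+ p)%g \in H).
Hypothesis coverF : forall x, x \in F 0%N -> exists2 h, h \in H & exists n, x = (h * g ^+ n)%g.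
Hypothesis HF : H \subset F 0%N.

Let X := rho g - 1.

(** The subtraction d - e * w is truncated: once e * w >= d, the coefficient u only has to lie in
    [ifil K 0]. *)
Inductive step_fil (d : nat) : A -> Prop :=
| step_fil0 : step_fil d 0
| step_filD a b : step_fil d a -> step_fil d b -> step_fil d (a + b)
| step_fil_gen u e : (e < p)%N -> ifil K (d - e * w) u -> step_fil d (u * X ^+ e).

Let nK : np_series K := np_series_cap H nF.

Lemma step_filN d a : step_fil d a -> step_fil d (- a).
Proof.
elim=> [|{}a b _ ha _ hb|u e ep hu]; first by rewrite oppr0; apply: step_fil0.
  by rewrite opprD; apply: step_filD.
by rewrite -mulNr; apply: step_fil_gen => //; apply: ifilN.
Qed.

Lemma step_fil_weaken d e a : (e <= d)%N -> step_fil d a -> step_fil e a.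
Proof.
move=> ed; elim=> [|{}a b _ ha _ hb|u f fp hu]; [exact: step_fil0|exact: step_filD|].
by apply: step_fil_gen => //; apply: ifil_weaken hu; rewrite leq_sub2r.
Qed.

(** If the exponent of X reaches p, then X^p = g^p - 1 by Frobenius; as g^p lies in H with weight p
    * w, this factor is absorbed into the coefficient without loss of weight. *)
Lemma step_filMX d a : step_fil d a -> step_fil (d + w) (a * X).
Proof.
elim=> [|{}a b _ ha _ hb|u e ep hu]; first by rewrite mul0r; apply: step_fil0.
  by rewrite mulrDl; apply: step_filD.
rewrite -mulrA -exprSr; move: ep; rewrite leq_eqVlt => /predU1P[Ee|ep].
  rewrite Ee frobenius_sub1 -rhoX -[_ * _]mulr1 -(expr0 X).
  apply: step_fil_gen; first exact: prime_gt0.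
  have gp : (g ^+ p)%g \in K (p * w)%N by rewrite inE gpH andbT np_expp // Fw.
  by apply: ifil_weaken (ifilM hu (ifil_h gp)); rewrite -Ee; nia.
by apply: step_fil_gen => //; apply: ifil_weaken hu; nia.
Qed.

(** Conjugation by g replaces a factor h - 1 by h' - 1, and h' differs from h by the commutator
    [h, g^-1], whose weight exceeds that of h by w. Products are handled by telescoping. *)
Lemma ifil_conj d v : ifil K d v ->
  ifil K d (rho g * v * rho (g^-1)%g) /\ ifil K (d + w) (rho g * v * rho (g^-1)%g - v).
Proof.
have gg : rho g * rho (g^-1)%g = 1 by rewrite -rhoM mulgV rho1.
have gg' : rho (g^-1)%g * rho g = 1 by rewrite -rhoM mulVg rho1.
elim=> [{}d||{}d u u' _ [a1 a2] _ [b1 b2]|{}d u _ [a1 a2]|{}d i u h hu [a1 a2] hi|{}d e u le _ [a1 a2]].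
- by rewrite mulr0 mul0r subr0; split; apply: ifil0.
- by rewrite mulr1 gg subrr; split; [apply: ifil1|apply: ifil0].
- rewrite mulrDr mulrDl; split; first exact: ifilD.
  by rewrite opprD addrACA; apply: ifilD.
- rewrite mulrN mulNr; split; first exact: ifilN.
  by rewrite -opprD; apply: ifilN.
- set h' := (h ^ g^-1)%g.
  have h'i : h' \in K i.
    have gN : (g^-1)%g \in 'N(K i)%g.
      by rewrite groupV; apply: (fintype.subsetP _ _ gF); rewrite normsI // np_norm.
    by rewrite memJ_norm.
  have E : rho g * (u * (rho h - 1)) * rho (g^-1)%g = (rho g * u * rho (g^-1)%g) * (rho h' - 1).
    have -> : rho h' = rho g * rho h * rho (g^-1)%g by rewrite /h' conjgE invgK mulgA !rhoM.
    rewrite !mulrBr !mulr1 mulrBl !mulrA; congr (_ - _).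
    by rewrite -!mulrA [rho (g^-1)%g * (rho g * _)]mulrA gg' mul1r.
  rewrite E; split; first exact: ifilMh.
  set u' := rho g * u * rho (g^-1)%g in a1 a2 *.
  have -> : u' * (rho h' - 1) - u * (rho h - 1) = (u' - u) * (rho h' - 1) + u * (rho h' - rho h).
    have -> : rho h' - rho h = (rho h' - 1) - (rho h - 1) by rewrite opprB addrA subrK.
    by rewrite mulrBl [X in _ = _ + X]mulrBr addrA subrK.
  apply: ifilD.
    by rewrite addnAC; apply: ifilMh.
  have -> : rho h' - rho h = (rho h - 1) * (rho [~ h, g^-1]%g - 1) + (rho [~ h, g^-1]%g - 1).
    by rewrite -{2}[rho [~ h, g^-1]%g - 1]mul1r -mulrDl subrK mulrBr mulr1 -rhoM -conjg_mulR.
  have cK : [~ h, g^-1]%g \in K (i + w)%N.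
    rewrite inE; apply/andP; split.
      apply: (fintype.subsetP (np_comm nF i w)); rewrite mem_commg ?groupV ?Fw //.
      by move: hi; rewrite inE => /andP[].
    have hH : h \in H by move: hi; rewrite inE => /andP[].
    rewrite commgEl groupM ?groupV // memJ_norm // groupV.
    exact: (fintype.subsetP nH).
  rewrite mulrDr; apply: ifilD.
    rewrite mulrA; apply: ifil_weaken (ifilMh (ifilMh hu hi) cK); lia.
  by rewrite -addnA; apply: ifilMh.
- by split; [apply: ifil_weaken a1|apply: ifil_weaken a2; rewrite leq_add2r].
Qed.

(** The coefficient v is moved to the left of X by X v = v' X + (v' - v), where v' is the conjugate
    of v; the correction loses a factor X but gains weight w by [ifil_conj]. *)
Lemma step_filXM e d k v u : (e < p)%N -> ifil K d v -> ifil K k u ->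
  step_fil (k + e * w + d) (u * X ^+ e * v).
Proof.
elim: e d v u k => [|e IH] d v u k ep hv hu.
  rewrite expr0 mulr1 -[_ * _]mulr1 -(expr0 X); apply: step_fil_gen; first exact: prime_gt0.
  by rewrite mul0n addn0 subn0; apply: ifilM.
have [c1 c2] := ifil_conj hv.
set v' := rho g * v * _ in c1 c2.
have E : X * v = v' * X + (v' - v).
  rewrite /X mulrBl mul1r mulrBr mulr1 addrA subrK; congr (_ - _).
  by rewrite /v' -!mulrA -rhoM mulVg rho1 mulr1.
clearbody v'; rewrite exprSr -!mulrA E mulrDr mulrDr; apply: step_filD.
  rewrite !mulrA; apply: step_fil_weaken (step_filMX (IH _ _ _ _ (ltnW ep) c1 hu)).
  by lia.
by rewrite !mulrA; apply: step_fil_weaken (IH _ _ _ _ (ltnW ep) c2 hu); lia.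
Qed.

Lemma ifil_step d a : ifil F d a -> step_fil d a.
Proof.
elim=> [{}d||{}d u u' _ a1 _ a2|{}d u _ a1|{}d i u h _ a1 hi|{}d e u le _ a1].
- exact: step_fil0.
- rewrite -[1]mulr1 -(expr0 X); apply: step_fil_gen; first exact: prime_gt0.
  exact: ifil1.
- exact: step_filD.
- exact: step_filN.
- have mulH y j : y \in K j -> step_fil (d + j) (u * (rho y - 1)).
    move=> yj; elim: a1 => [|u1 u2 _ h1 _ h2|v e ep hv]; first by rewrite mul0r; apply: step_fil0.
      by rewrite mulrDl; apply: step_filD.
    by apply: step_fil_weaken (step_filXM ep (ifil_h yj) hv); lia.
  case: (ltnP w i) => [wi|iw].
    apply: mulH; rewrite inE hi (fintype.subsetP FH) //.
    by apply: (fintype.subsetP (np_antiW nF wi)).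
  (* Here i <= w. Since [F w] is all of [F 0], the factor h - 1 may be counted with weight w; it is
     then built up from y in H and n factors g. *)
  have : h \in F 0%N by apply: (fintype.subsetP (np_antiW nF (leq0n i))).
  move=> /coverF[y yH [n ->]]; rewrite rhoM rhoX.
  have yK : y \in K w by rewrite inE yH andbT Fw (fintype.subsetP HF).
  apply: (@step_fil_weaken (d + w)); first by rewrite leq_add2l.
  elim: n => [|n IH]; first by rewrite expr0 mulr1; apply: mulH.
  set r := rho y * rho g ^+ n in IH *.
  have -> : u * (rho y * rho g ^+ n.+1 - 1) = u * (r - 1) * X + u * (r - 1) + u * X.
    have -> : rho y * rho g ^+ n.+1 - 1 = (r - 1) * rho g + X.
      by rewrite mulrBl mul1r /X addrA subrK exprSr mulrA.
    by rewrite mulrDr mulrA -[in LHS](subrK 1 (rho g)) -/X mulrDr mulr1.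
  apply: step_filD; last exact: step_filMX a1.
  by apply: step_filD => //; apply: step_fil_weaken (step_filMX IH); rewrite leq_addr.
- exact: step_fil_weaken a1.
Qed.

End Step.

Lemma ifilS F F' d a : (forall i, F i \subset F' i) -> ifil F d a -> ifil F' d a.
Proof.
move=> sF; elim=> [{}d||{}d u u' _ h1 _ h2|{}d u _ h|{}d i u h _ h1 hi|{}d e u le _ h].
- exact: ifil0.
- exact: ifil1.
- exact: ifilD.
- exact: ifilN.
- by apply: ifilMh => //; apply: (fintype.subsetP (sF i)).
- exact: ifil_weaken h.
Qed.

Lemma ifilX F d a e : ifil F d a -> ifil F (e * d) (a ^+ e).
Proof.
move=> fa; elim: e => [|e IH]; first by rewrite expr0; apply: ifil1.
by rewrite exprS mulSn; apply: ifilM.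
Qed.

Lemma ifil_trivial F d a : (forall i, F i :=: 1%g) -> ifil F d a -> (0 < d)%N -> a = 0.
Proof.
move=> F1; elim=> [//|//|{}d u u' _ h1 _ h2 d0|{}d u _ h d0|{}d i u h _ _ hi _|{}d e u le _ h e0].
- by rewrite h1 ?h2 ?addr0.
- by rewrite h ?oppr0.
- by move: hi; rewrite F1 => /set1P ->; rewrite rho1 subrr mulr0.
- by apply: h; apply: leq_trans le.
Qed.

Lemma maximal_subgroup_cover (P H : {group gT}) (g : gT) :
  pgroup p P -> maximal H P -> g \in P -> g \notin H ->
  (g ^+ p)%g \in H /\
  forall x, x \in P -> exists2 h, h \in H & exists n, x = (h * g ^+ n)%g.
Proof.
move=> pP mH gP gH.
have nHP := normal_norm (p_maximal_normal pP mH).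
have sHP := normal_sub (p_maximal_normal pP mH).
split.
  have gN : g \in 'N(H)%g := fintype.subsetP nHP g gP.
  apply: coset_idr; first by rewrite groupX.
  rewrite morphX //= -(p_maximal_index pP mH) -card_quotient //.
  by apply: expg_cardG; apply: mem_quotient.
have E : (H * <[g]>)%g = P.
  by rewrite (mulg_normal_maximal (p_maximal_normal pP mH)) ?cycle_subG.
by move=> x; rewrite -E => /mulsgP[h _ hH /cycleP[n ->] ->]; exists h => //; exists n.
Qed.

Lemma np_jump F L : F L :=: 1%g -> np_series F -> F 0%N :!=: 1%g ->
  exists w, F w :=: F 0%N /\ F w.+1 \proper F 0%N.
Proof.
move=> FL nF nt.
have bd i : F i :==: F 0%N -> (i <= L)%N.
  move=> /eqP E; rewrite leqNgt; apply/negP => Li; move: nt; rewrite -E.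
  by rewrite -subG1 -FL np_antiW // ltnW.
have [w /eqP Ew wmax] := ex_maxnP (ex_intro (fun i => F i :==: F 0%N) 0%N (eqxx _)) bd.
exists w; split=> //; rewrite finset.properEneq np_antiW // andbT.
by apply/negP => /wmax; rewrite ltnn.
Qed.

(* Jennings' theorem, with the group ring replaced by any ring of characteristic
   p receiving the group. The list ws holds the index i once for each dimension
   of F i / F i.+1, and b enumerates the monomials in the g - 1. *)
Theorem jennings (R : comNzSemiRingType) F L :
  np_series F -> pgroup p (F 0%N) -> F L :=: 1%g ->
  exists (ws : seq nat) (J : finType) (_ : J) (wt : J -> nat) (b : J -> A),
  [/\ forall i, logn p #|F i| = count (leq i) ws,
      forall t : R, \sum_j t ^+ wt j = \prod_(w <- ws) \sum_(e < p) t ^+ (w * e),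
      forall j, ifil F (wt j) (b j),
      forall x, x \in F 0%N -> exists c : J -> nat, rho x = \sum_j b j *+ c j
    & forall d a, ifil F d a -> (p.-1 * sumn ws < d)%N -> a = 0].
Proof.
have [n] := ubnP #|F 0%N|; elim: n F => // n IH F ltn nF pF FL.
have [F1|nt] := eqVneq (gval (F 0%N)) 1%g.
  have Fi i : F i :=: 1%g.
    by apply/trivgP; rewrite -F1; apply: np_antiW.
  exists [::], unit, tt, (fun=> 0%N), (fun=> 1); split=> //.
  - by move=> i; rewrite Fi cards1 logn1.
  - by move=> t; rewrite big_nil (big_pred1 tt) ?expr0 // => -[].
  - by move=> _; apply: ifil1.
  - move=> x; rewrite F1 => /set1P ->; exists (fun=> 1%N).
    by rewrite rho1 (big_pred1 tt) // => -[].
  - move=> d a fa; rewrite muln0; exact: ifil_trivial fa.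
have [w [Fw Fw1]] := np_jump FL nF nt.
have [E|[H mH FH]] := maximal_exists (fintype.proper_sub Fw1).
  by rewrite E fintype.properxx in Fw1.
have nHF := p_maximal_normal pF mH; have [sHF nH] := andP nHF.
have /fintype.properP[_ [g gF gH]] := maxgroupp mH.
have [gpH cov] := maximal_subgroup_cover pF mH gF gH.
set K := (fun i => F i :&: H)%G.
have K0 : K 0%N :=: H by apply/finset.setIidPr.
have cF : (#|F 0%N| = #|H| * p)%N by rewrite -(p_maximal_index pF mH) Lagrange.
have [||||ws [J [j0 [wt [b [b1 b2 b3 b4 b5]]]]]] := IH K.
- rewrite K0 -ltnS; apply: leq_trans ltn; rewrite ltnS cF.
  by rewrite ltn_Pmulr ?cardG_gt0 ?prime_gt1.
- exact: np_series_cap.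
- by rewrite K0; apply: pgroupS pF.
- by apply/trivgP; rewrite /= FL finset.subsetIl.
pose X := rho g - 1.
(* Each monomial of H is multiplied by the powers X^e with e < p, each contributing weight e * w. *)
exists (w :: ws), (J * 'I_p)%type, (j0, Ordinal (prime_gt0 p_prime)).
exists (fun u : J * 'I_p => wt u.1 + u.2 * w)%N, (fun u : J * 'I_p => b u.1 * X ^+ u.2); split.
- move=> i /=; rewrite -b1; case: (leqP i w) => iw.
    have Ei : F i :=: F 0%N.
      apply/eqP; rewrite finset.eqEsubset np_antiW //=.
      by rewrite -Fw np_antiW.
    have -> : K i :=: H by rewrite /= Ei; apply/finset.setIidPr.
    by rewrite Ei cF lognM ?cardG_gt0 ?prime_gt0 // addnC logn_prime ?eqxx.
  have -> : K i :=: F i.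
    by apply/finset.setIidPl; apply: fintype.subset_trans FH; apply: np_antiW.
  by rewrite add0n.
- move=> t; rewrite big_cons -b2 mulrC mulr_suml.
  rewrite -(pair_bigA _ (fun j (e : 'I_p) => t ^+ (wt j + e * w))) /=.
  apply: eq_bigr => j _; rewrite mulr_sumr; apply: eq_bigr => e _.
  by rewrite exprD mulnC.
- move=> [j e] /=; apply: ifilM.
    by apply: ifilS (b3 j) => i; apply: finset.subsetIl.
  by apply: ifilX; apply: ifil_h; rewrite Fw.
- move=> x xF; have [h hH [m ->]] := cov x xF.
  (* Powers of g^p are moved into H, so that the remaining power of g = 1 + X has exponent below p
     and expands into admissible powers of X. *)
  rewrite (divn_eq m p) expgD mulgA mulnC expgM.
  have h'H : (h * g ^+ p ^+ (m %/ p))%g \in K 0%N by rewrite K0; apply: groupM => //; apply: groupX.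
  have [c Ec] := b4 _ h'H; exists (fun u : J * 'I_p => (c u.1 * 'C(m %% p, u.2))%N).
  rewrite rhoM Ec rhoX -[rho g](subrK 1) -/X exprD1n.
  rewrite -(pair_bigA _ (fun j (e : 'I_p) => (b j * X ^+ e) *+ (c j * 'C(m %% p, e)))) /=.
  rewrite mulr_suml; apply: eq_bigr => j _; rewrite mulr_sumr.
  have lt : ((m %% p).+1 <= p)%N by rewrite ltn_mod prime_gt0.
  rewrite (big_ord_widen p (fun e => b j *+ c j * (X ^+ e *+ 'C(m %% p, e))) lt).
  rewrite big_mkcond; apply: eq_bigr => e _; case: ifPn => [_|].
    by rewrite mulrnAr mulrnAl -mulrnA.
  by rewrite -leqNgt => le; rewrite bin_small // muln0 mulr0n.
- move=> d a /(ifil_step nF Fw FH nH gF gpH cov sHF).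
  elim=> [//|{}a a' _ ha _ ha' lt|u e ep hu lt]; first by rewrite ha ?ha' ?addr0.
  (* As e <= p - 1, the coefficient u still has weight above [p.-1 * sumn ws], so it vanishes by
     induction. *)
  rewrite (b5 _ _ hu) ?mul0r //.
  move: lt; rewrite /= mulnDr => lt.
  rewrite ltn_subRL; apply: leq_ltn_trans lt; rewrite leq_add2r.
  by rewrite leq_mul2r -ltnS prednK ?ep ?orbT ?prime_gt0.
Qed.
End PpowerFiltration.

(** * Tight tensors *)

Section LeadingTerms.
Variables (K : fieldType) (J X : finType) (wt : J -> nat) (j0 : J).
Variables (D : {pred X}) (alpha : X -> int) (e : X -> J -> K).
Hypothesis alpha_inj : {in D &, injective alpha}.
Hypothesis dual : forall x, x \in D -> exists f : J -> K,
  forall x', x' \in D -> \sum_j e x' j * f j = (x' == x)%:R.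

Definition lower_comb (x : X) (c : X -> K) : Prop :=
  c x = 1 /\ forall x', c x' != 0 -> x' \in D /\ alpha x' <= alpha x.

(* Gaussian elimination: among the combinations of e x with lower rows, pick one
   whose first nonzero coordinate, in order of weight, comes as late as possible. *)
Lemma leading_terms : exists (lead : X -> J) (c : X -> X -> K),
  {in D &, injective lead} /\
  forall x, x \in D -> lower_comb x (c x) /\
    forall j, (wt j < wt (lead x))%N -> \sum_x' c x x' * e x' j = 0.
Proof.
(* The weight with ties broken by the enumeration of J, which orders the coordinates linearly. *)
pose k j := (wt j * #|J| + enum_rank j)%N.
have k_inj : injective k.
  move=> j j' E; apply: enum_rank_inj; apply: val_inj => /=.
  have := congr1 (modn^~ #|J|) E; rewrite /k !modnMDl !modn_small //; exact: ltn_ord.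
have k_wt j j' : (wt j < wt j')%N -> (k j < k j')%N.
  move=> lt; rewrite /k; apply: leq_trans (leq_addr _ _).
  apply: leq_trans (leq_mul lt (leqnn _)).
  by rewrite mulSnr -addnS leq_add2l ltn_ord.
pose van d x c := lower_comb x c /\ forall j, (k j < d)%N -> \sum_x' c x' * e x' j = 0.
pose P x d := `[< exists c, van d x c >].
have exP x : x \in D -> exists d, P x d.
  move=> xD; exists 0%N; apply/asboolP; exists (fun x' => (x' == x)%:R).
  split=> //; split; first by rewrite eqxx.
  by move=> x'; case: (eqVneq x' x) => [-> //|_]; rewrite eqxx.
(* Not all coordinates can vanish: pairing the combination with the functional dual to x gives c x =
   1. So a latest first nonzero coordinate exists. *)
have bdP x : x \in D -> forall d, P x d -> (d <= \sum_j (k j).+1)%N.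
  move=> xD d /asboolP[c [[cx cs] cv]]; rewrite leqNgt; apply/negP => lt.
  have [f fP] := dual xD.
  have : \sum_x' c x' * (\sum_j e x' j * f j) = 0.
    under eq_bigr do rewrite mulr_sumr.
    rewrite exchange_big big1 // => j _.
    under eq_bigr do rewrite mulrA.
    rewrite -mulr_suml cv ?mul0r //; apply: leq_trans lt.
    by rewrite ltnW // ltnS (bigD1 j) //= leq_addr.
  rewrite (bigD1 x) //= fP // eqxx cx mulr1 big1 ?addr0; last first.
    move=> x' nx; case: (eqVneq (c x') 0) => [->|/cs[x'D _]]; first by rewrite mul0r.
    by rewrite fP // (negPf nx) mulr0.
  by move/eqP; rewrite oner_eq0.
have main x : exists jc : J * (X -> K), x \in D ->
    [/\ van (k jc.1) x jc.2, \sum_x' jc.2 x' * e x' jc.1 != 0 & ~ P x (k jc.1).+1].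
  case: (boolP (x \in D)) => xD; last by exists (j0, fun=> 0).
  have [d /asboolP[c [lc cv]] dmax] := ex_maxnP (exP x xD) (bdP x xD).
  have nP : ~ P x d.+1 by move=> /dmax; rewrite ltnn.
  have [j kj nz] : exists2 j, k j = d & \sum_x' c x' * e x' j != 0.
    apply: contrapT => nj; apply: nP; apply/asboolP; exists c; split=> // j.
    rewrite ltnS leq_eqVlt => /predU1P[kj|/cv //].
    by apply/eqP; apply: contrapT => /negP nz; apply: nj; exists j.
  by exists (j, c) => _; split=> //=; rewrite kj.
have [jc jcP] := boolp.choice main.
exists (fun x => (jc x).1), (fun x => (jc x).2); split; last first.
  move=> x xD; have [[lc cv] _ _] := jcP x xD; split=> // j lt.
  exact/cv/k_wt.
(* If x and y shared a leading coordinate with alpha x < alpha y, subtracting a multiple of the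
   combination of x from that of y would cancel it. The coefficient at y stays 1, which contradicts
   the maximality for y. *)
have asym x y : x \in D -> y \in D -> (jc x).1 = (jc y).1 -> ~ alpha x < alpha y.
  move=> xD yD Ej lt.
  have [[[cx1 cxs] cxv] nzx nPx] := jcP x xD; have [[[cy1 cys] cyv] _] := jcP y yD.
  case; apply/asboolP; rewrite -Ej in cyv *; set j := (jc x).1 in cxv nzx cyv *.
  set a := (\sum_x' (jc y).2 x' * e x' j) / (\sum_x' (jc x).2 x' * e x' j).
  exists (fun x' => (jc y).2 x' - a * (jc x).2 x').
  have cxy : (jc x).2 y = 0.
    by apply/eqP; apply: contrapT => /negP /cxs[_]; rewrite leNgt lt.
  split; first split.
  - by rewrite cxy mulr0 subr0.
  - move=> x'; case: (eqVneq ((jc y).2 x') 0) => [->|/cys //].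
    rewrite sub0r oppr_eq0 mulf_eq0 negb_or => /andP[_ /cxs[x'D le]].
    by split=> //; apply: le_trans le (ltW lt).
  move=> j'; rewrite ltnS leq_eqVlt => lej.
  under eq_bigr do rewrite mulrBl -mulrA.
  rewrite sumrB -mulr_sumr.
  case/predU1P: lej => [/k_inj ->|lt']; first by rewrite divfK ?subrr.
  by rewrite cxv // cyv // mulr0 subr0.
move=> x y xD yD Ej; apply: alpha_inj => //.
by case: (ltgtP (alpha x) (alpha y)) => // /asym[].
Qed.

End LeadingTerms.

Section TightTensor.
Variables (K : fieldType) (J : finType) (j0 : J) (wt : J -> nat) (D : nat).
Variables (X Y Z : finType) (DX : {pred X}) (DY : {pred Y}) (DZ : {pred Z}).
Variables (eX : X -> J -> K) (eY : Y -> J -> K) (eZ : Z -> J -> K).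
Variables (T : J -> J -> J -> K) (Phi : X -> Y -> Z -> bool).
Variables (aX : X -> int) (aY : Y -> int) (aZ : Z -> int).
Hypothesis T_wt : forall i j k, (D < wt i + wt j + wt k)%N -> T i j k = 0.
Hypothesis PhiE : forall x y z, x \in DX -> y \in DY -> z \in DZ ->
  \sum_i \sum_j \sum_k eX x i * eY y j * eZ z k * T i j k = (Phi x y z)%:R.
Hypotheses (aX_inj : {in DX &, injective aX}) (aY_inj : {in DY &, injective aY}).
Hypothesis aZ_inj : {in DZ &, injective aZ}.
Hypothesis tight : forall x y z, x \in DX -> y \in DY -> z \in DZ ->
  Phi x y z -> aX x + aY y + aZ z = 0.
Hypothesis liftX : forall x, x \in DX -> exists y z, [/\ y \in DY, z \in DZ & Phi x y z].
Hypothesis liftY : forall y, y \in DY -> exists x z, [/\ x \in DX, z \in DZ & Phi x y z].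
Hypothesis liftZ : forall z, z \in DZ -> exists x y, [/\ x \in DX, y \in DY & Phi x y z].

(* The support is an antichain for the ranks, so replacing rows by their reduced
   combinations does not change the value of the tensor on it. *)
Lemma tight_tensor_leads : exists (lX : X -> J) (lY : Y -> J) (lZ : Z -> J),
  [/\ {in DX &, injective lX}, {in DY &, injective lY}, {in DZ &, injective lZ}
    & forall x y z, x \in DX -> y \in DY -> z \in DZ -> Phi x y z ->
        (wt (lX x) + wt (lY y) + wt (lZ z) <= D)%N].
Proof.
(* The dual functional is a slice of the tensor: with y and z completing x to a supported triple,
   tightness forces any other x' supported with y and z to have the rank of x. *)
have dX x : x \in DX -> exists f : J -> K,
    forall x', x' \in DX -> \sum_j eX x' j * f j = (x' == x)%:R.
  move=> xD; have [y [z [yD zD xyz]]] := liftX xD.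
  exists (fun i => \sum_j \sum_k eY y j * eZ z k * T i j k) => x' x'D.
  transitivity ((Phi x' y z)%:R : K).
    rewrite -PhiE //; apply: eq_bigr => i _; rewrite mulr_sumr; apply: eq_bigr => j _.
    by rewrite mulr_sumr; apply: eq_bigr => k _; rewrite !mulrA.
  congr (_%:R : K); congr nat_of_bool.
  apply/idP/eqP => [xyz'|-> //]; apply: aX_inj => //.
  have := tight x'D yD zD xyz'; rewrite -(tight xD yD zD xyz) => /addIr.
  exact: addIr.
have dY y : y \in DY -> exists f : J -> K,
    forall y', y' \in DY -> \sum_j eY y' j * f j = (y' == y)%:R.
  move=> yD; have [x [z [xD zD xyz]]] := liftY yD.
  exists (fun j => \sum_i \sum_k eX x i * eZ z k * T i j k) => y' y'D.
  transitivity ((Phi x y' z)%:R : K).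
    rewrite -PhiE // [RHS]exchange_big; apply: eq_bigr => j _.
    rewrite mulr_sumr; apply: eq_bigr => i _.
    by rewrite mulr_sumr; apply: eq_bigr => k _; rewrite !mulrA [eY _ _ * _]mulrC.
  congr (_%:R : K); congr nat_of_bool.
  apply/idP/eqP => [xyz'|-> //]; apply: aY_inj => //.
  have := tight xD y'D zD xyz'; rewrite -(tight xD yD zD xyz) => /addIr.
  exact: addrI.
have dZ z : z \in DZ -> exists f : J -> K,
    forall z', z' \in DZ -> \sum_j eZ z' j * f j = (z' == z)%:R.
  move=> zD; have [x [y [xD yD xyz]]] := liftZ zD.
  exists (fun k => \sum_i \sum_j eX x i * eY y j * T i j k) => z' z'D.
  transitivity ((Phi x y z')%:R : K).
    rewrite -PhiE //; under [in RHS]eq_bigr do rewrite exchange_big.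
    rewrite [RHS]exchange_big; apply: eq_bigr => k _.
    rewrite mulr_sumr; apply: eq_bigr => i _.
    by rewrite mulr_sumr; apply: eq_bigr => j _; rewrite mulrCA !mulrA.
  congr (_%:R : K); congr nat_of_bool.
  apply/idP/eqP => [xyz'|-> //]; apply: aZ_inj => //.
  have := tight xD yD z'D xyz'; rewrite -(tight xD yD zD xyz).
  exact: addrI.
have [lX [cX [lXi hX]]] := leading_terms wt j0 aX_inj dX.
have [lY [cY [lYi hY]]] := leading_terms wt j0 aY_inj dY.
have [lZ [cZ [lZi hZ]]] := leading_terms wt j0 aZ_inj dZ.
exists lX, lY, lZ; split=> // x y z xD yD zD xyz; rewrite leqNgt; apply/negP => lt.
have [[cx1 cxs] cxv] := hX x xD; have [[cy1 cys] cyv] := hY y yD.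
have [[cz1 czs] czv] := hZ z zD.
(* The tensor is evaluated on the three reduced combinations. Their coordinates vanish below the
   leading weights, whose total is assumed to exceed D, so every term is 0. *)
have : \sum_x' \sum_y' \sum_z' cX x x' * cY y y' * cZ z z' *
    (\sum_i \sum_j \sum_k eX x' i * eY y' j * eZ z' k * T i j k) = 0.
  transitivity (\sum_i \sum_j \sum_k (\sum_x' cX x x' * eX x' i) *
     (\sum_y' cY y y' * eY y' j) * (\sum_z' cZ z z' * eZ z' k) * T i j k).
    under eq_bigr do under eq_bigr do under eq_bigr do rewrite mulr_sumr.
    under eq_bigr do under eq_bigr do rewrite exchange_big.
    under eq_bigr do rewrite exchange_big.
    rewrite exchange_big; apply: eq_bigr => i _.
    under eq_bigr do under eq_bigr do under eq_bigr do rewrite mulr_sumr.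
    under eq_bigr do under eq_bigr do rewrite exchange_big.
    under eq_bigr do rewrite exchange_big.
    rewrite exchange_big; apply: eq_bigr => j _.
    under eq_bigr do under eq_bigr do under eq_bigr do rewrite mulr_sumr.
    under eq_bigr do under eq_bigr do rewrite exchange_big.
    under eq_bigr do rewrite exchange_big.
    rewrite exchange_big; apply: eq_bigr => k _.
    rewrite !mulr_suml; apply: eq_bigr => x' _.
    rewrite [X in X * _ * _]mulr_sumr !mulr_suml; apply: eq_bigr => y' _.
    rewrite mulr_sumr !mulr_suml; apply: eq_bigr => z' _.
    by ring.
  apply: big1 => i _; apply: big1 => j _; apply: big1 => k _.
  have [li|li] := ltnP (wt i) (wt (lX x)); first by rewrite cxv // !mul0r.
  have [lj|lj] := ltnP (wt j) (wt (lY y)); first by rewrite cyv // mulr0 !mul0r.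
  have [lk|lk] := ltnP (wt k) (wt (lZ z)); first by rewrite czv // mulr0 mul0r.
  by rewrite T_wt ?mulr0 //; lia.
(* The same value is also 1: the combinations only involve ranks at most those of x, y, z, and on
   the support the ranks sum to 0, so all three must be equal. *)
have E x' y' z' : cX x x' * cY y y' * cZ z z' *
    (\sum_i \sum_j \sum_k eX x' i * eY y' j * eZ z' k * T i j k) =
    [&& x' == x, y' == y & z' == z]%:R.
  case: (eqVneq (cX x x') 0) => [c0|/cxs[x'D lex]].
    by case: eqVneq c0 => [->|_] c0; [move/eqP: c0; rewrite cx1 oner_eq0|rewrite c0 !mul0r].
  case: (eqVneq (cY y y') 0) => [c0|/cys[y'D ley]].
    rewrite c0 mulr0 !mul0r; case: (eqVneq y' y) c0 => [->|_] c0; last by rewrite andbF.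
    by move/eqP: c0; rewrite cy1 oner_eq0.
  case: (eqVneq (cZ z z') 0) => [c0|/czs[z'D lez]].
    rewrite c0 mulr0 !mul0r; case: (eqVneq z' z) c0 => [->|_] c0; last by rewrite !andbF.
    by move/eqP: c0; rewrite cz1 oner_eq0.
  rewrite PhiE //; case: (boolP (Phi x' y' z')) => xyz'; last first.
    rewrite mulr0; case: and3P xyz' => // -[/eqP-> /eqP-> /eqP->].
    by rewrite xyz.
  have e' := tight x'D y'D z'D xyz'; have e := tight xD yD zD xyz.
  have -> : x' = x by apply: aX_inj => //; lia.
  have -> : y' = y by apply: aY_inj => //; lia.
  have -> : z' = z by apply: aZ_inj => //; lia.
  by rewrite !eqxx cx1 cy1 cz1 !mulr1.
under eq_bigr do under eq_bigr do under eq_bigr do rewrite E.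
rewrite (bigD1 x) //= (bigD1 y) //= (bigD1 z) //= !eqxx /=.
rewrite big1 ?addr0; last by move=> z' /negPf->.
rewrite big1 ?addr0; last by move=> y' /negPf-> /=; rewrite big1.
rewrite big1 ?addr0; last by move=> x' /negPf-> /=; rewrite big1 // => y' _; rewrite big1.
by move/eqP; rewrite oner_eq0.
Qed.

End TightTensor.

(** * Estimates of the generating function *)

Section Estimates.
Variable R : realType.
Implicit Types (x y q : R).

Lemma amgm3 (u v w : R) :
  3 * expR ((u + v + w) / 3) <= expR u + expR v + expR w.
Proof.
have cube (a : R) : expR a = expR (a / 3) ^+ 3.
  by rewrite -expRM_natl; congr expR; field.
have -> : (u + v + w) / 3 = u / 3 + v / 3 + w / 3 by field.
rewrite !expRD (cube u) (cube v) (cube w).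
have := expR_gt0 (w / 3); have := expR_gt0 (v / 3); have := expR_gt0 (u / 3).
move: (expR (u / 3)) (expR (v / 3)) (expR (w / 3)) => a b c a0 b0 c0.
rewrite -subr_ge0.
have -> : a ^+ 3 + b ^+ 3 + c ^+ 3 - 3 * (a * b * c) =
  (a + b + c) * ((a - b) ^+ 2 + (b - c) ^+ 2 + (c - a) ^+ 2) / 2 by field.
by rewrite divr_ge0 // mulr_ge0 ?addr_ge0 ?sqr_ge0 // ltW.
Qed.

(** A weak form of cosh y <= exp (y^2 / 2). For |y| >= 1 each exponential is at most exp (y^2); for
    |y| < 1 the inequality 1 + a <= exp a suffices, applied at y / 2. *)
Lemma expR_sym_le (y q : R) : `|y| <= q -> expR y + expR (- y) <= 2 * expR (q ^+ 2).
Proof.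
move=> yq; apply: (@le_trans _ _ (2 * expR (y ^+ 2))); last first.
  rewrite ler_pM2l // ler_expR -[y ^+ 2]real_normK ?num_real //.
  by rewrite ler_sqr ?nnegrE // (le_trans _ yq).
have [y1|y1] := lerP 1 `|y|.
  have le1 (z : R) : `|z| = `|y| -> expR z <= expR (y ^+ 2).
    move=> zy; rewrite ler_expR (le_trans (ler_norm z)) // zy.
    by rewrite -[y ^+ 2]real_normK ?num_real // expr2 ler_peMl.
  by rewrite mulr_natl mulr2n lerD // le1 // normrN.
set z := y / 2; set s := z ^+ 2.
have s4 : s < 4^-1.
  have -> : s = `|y| ^+ 2 / 4 by rewrite /s /z real_normK ?num_real //; field.
  by have := normr_ge0 y; nra.
have s0 : 0 <= s by exact: sqr_ge0.
have zb : -1 < z < 1.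
  by move: y1; rewrite ltr_norml /z => /andP[? ?]; apply/andP; split; lra.
have half (a : R) : a < 1 -> expR (2 * a) <= ((1 - a) ^+ 2)^-1.
  move=> a1; rewrite -[leLHS]invrK -expRN lef_pV2 ?posrE ?expR_gt0 ?exprn_gt0 ?subr_gt0 //.
  rewrite -mulrN expRM_natl ler_sqr ?nnegrE ?expR_ge0 ?subr_ge0 ?(ltW a1) //.
  exact: expR_ge1Dx.
have -> : y ^+ 2 = 4 * s by rewrite /s /z; field.
have -> : y = 2 * z by rewrite /z; field.
case/andP: zb => zb1 zb2.
have h1 := half z zb2.
have h2 : expR (- (2 * z)) <= ((1 + z) ^+ 2)^-1.
  by rewrite -mulrN -[z in 1 + z]opprK; apply: half; lra.
apply: le_trans (lerD h1 h2) _.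
have -> : ((1 - z) ^+ 2)^-1 + ((1 + z) ^+ 2)^-1 = 2 * ((1 + s) / (1 - s) ^+ 2).
  rewrite /s; field; rewrite ?subr_eq0 ?addr_eq0.
  by apply/and3P; split; apply/eqP; nra.
rewrite ler_pM2l //.
have e2 : 1 + s <= expR s by exact: expR_ge1Dx.
(* The constant 4 / 3 is what s < 1 / 4 allows; the exponents s, twice 4 s / 3, and the spare s / 3
   add up to 4 s = y^2. *)
have e3 : (1 - s)^-1 <= expR (4 / 3 * s).
  apply: le_trans (expR_ge1Dx _).
  by rewrite -[leLHS]mul1r ler_pdivrMr; nra.
have -> : 4 * s = s + (4 / 3 * s + 4 / 3 * s) + s / 3 by field.
rewrite 3!expRD -[leLHS]mulr1; apply: ler_pM => //.
- by rewrite divr_ge0 ?exprn_ge0 //; lra.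
- rewrite expr2 invfM; apply: ler_pM => //; first by lra.
    by rewrite mulr_ge0 // invr_ge0; lra.
  by apply: ler_pM => //; rewrite invr_ge0; lra.
- by rewrite -expR0 ler_expR divr_ge0.
Qed.

(** Pairing e with p - 1 - e centres the exponents at -q, and [expR_sym_le] bounds each pair. *)
Lemma geometric_le (p : nat) (x : R) : (0 < p)%N -> 0 <= x ->
  \sum_(e < p) expR (- x * e%:R) <=
    p%:R * expR (- (x * p.-1%:R / 2) + (x * p.-1%:R / 2) ^+ 2).
Proof.
move=> p0 x0; set q := x * p.-1%:R / 2.
rewrite -(@ler_pM2l _ 2) // mulr_natl mulr2n.
rewrite [X in X + _](reindex_inj rev_ord_inj) -big_split /=.
have -> : 2 * (p%:R * expR (- q + q ^+ 2)) = \sum_(e < p) expR (- q) * (2 * expR (q ^+ 2)).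
  by rewrite sumr_const card_ord expRD -mulr_natl; ring.
apply: ler_sum => e _.
have pe : (p - e.+1)%:R = p.-1%:R - e%:R :> R.
  by rewrite -natrB; [congr _%:R; have := ltn_ord e; lia|have := ltn_ord e; lia].
set y := x * e%:R - q.
have -> : - x * (p - e.+1)%:R = - q + y by rewrite pe /y /q; field.
have -> : - x * e%:R = - q - y by rewrite /y /q; ring.
rewrite (expRD (- q) y) (expRD (- q) (- y)) -mulrDr ler_pM2l ?expR_gt0 //; apply: expR_sym_le.
have ep : e%:R <= p.-1%:R :> R by rewrite ler_nat; have := ltn_ord e; lia.
have e0 : 0 <= e%:R :> R by [].
by rewrite ler_norml /y /q; apply/andP; split; nra.
Qed.

Lemma prod_geometric_le (p : nat) (ws : seq nat) (kap : R) :
  (1 < p)%N -> 0 <= kap ->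
  let A : R := \sum_(w <- ws) w%:R in let B : R := \sum_(w <- ws) w%:R ^+ 2 in
  0 < B -> kap * (size ws)%:R * B <= A ^+ 2 ->
  exists2 lam : R, 0 <= lam &
    \prod_(w <- ws) (\sum_(e < p) expR (- lam) ^+ (w * e)) <=
      p%:R ^+ size ws * expR (- (kap / 36 * (size ws)%:R))
      * expR (- (lam * (p.-1 * sumn ws)%:R / 3)).
Proof.
move=> p1 kap0 A B B0 kAB.
have q0 : 0 < p.-1%:R :> R by rewrite ltr0n; lia.
have A0 : 0 <= A by apply: sumr_ge0.
(* With mu = lam (p - 1), the exponent left after extracting - mu A / 3 is - mu A / 6 + mu^2 B / 4,
   minimal at mu = A / (3 B), where it equals - A^2 / (36 B). *)
pose lam := A / (3 * B) / p.-1%:R.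
have lam0 : 0 <= lam.
  apply: divr_ge0; last exact: ltW.
  by apply: divr_ge0 => //; apply: mulr_ge0 => //; apply: ltW.
exists lam => //.
set mu := lam * p.-1%:R.
have step (w : nat) : \sum_(e < p) expR (- lam) ^+ (w * e) <=
    p%:R * expR (- (mu / 2) * w%:R + mu ^+ 2 / 4 * w%:R ^+ 2).
  have := @geometric_le p (lam * w%:R) (ltnW p1) (mulr_ge0 lam0 (ler0n _ w)).
  have -> : - (lam * w%:R * p.-1%:R / 2) + (lam * w%:R * p.-1%:R / 2) ^+ 2 =
      - (mu / 2) * w%:R + mu ^+ 2 / 4 * w%:R ^+ 2 by rewrite /mu; field.
  apply: le_trans; rewrite le_eqVlt; apply/orP; left; apply/eqP.
  apply: eq_bigr => e _; rewrite -expRM_natl; congr expR; rewrite natrM; ring.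
apply: (@le_trans _ _ (\prod_(w <- ws)
  (p%:R * expR (- (mu / 2) * w%:R + mu ^+ 2 / 4 * w%:R ^+ 2)))).
  apply: ler_prod => w _; rewrite step andbT; apply: sumr_ge0 => e _.
  by rewrite exprn_ge0 ?expR_ge0.
rewrite big_split /= big_const_seq count_predT iter_mulr_1 -mulrA.
rewrite ler_pM2l ?exprn_gt0 ?ltr0n //; last by lia.
rewrite -expR_sum -expRD ler_expR big_split /= -!mulr_sumr -/A -/B.
have -> : (p.-1 * sumn ws)%:R = p.-1%:R * A :> R.
  by rewrite natrM sumnE natr_sum.
have -> : lam * (p.-1%:R * A) = mu * A by rewrite /mu mulrA.
have muE : mu = A / (3 * B) by rewrite /mu /lam divfK ?gt_eqF.
have -> : - (mu / 2) * A + mu ^+ 2 / 4 * B =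
    - (A ^+ 2 / B / 36) - mu * A / 3.
  by rewrite muE; field; rewrite gt_eqF.
rewrite lerD2r lerN2 mulrAC ler_pM2r // ?invr_gt0 //.
by rewrite ler_pdivlMr.
Qed.

End Estimates.

(** * The tensor of the group ring and STPP constructions *)

Section RegularRepresentation.
Variables (K : nzRingType) (gT : finGroupType).

(** Right multiplication by x on row vectors; this realizes the group algebra inside a matrix
    ring. *)
Definition regular_mx (x : gT) : 'M[K]_#|gT| :=
  \matrix_(i, j) (enum_val i * x == enum_val j)%g%:R.

Lemma regular_mx1 : regular_mx 1%g = 1.
Proof. by apply/matrixP => i j; rewrite !mxE mulg1 (inj_eq enum_val_inj). Qed.

Lemma regular_mxM : {morph regular_mx : x y / (x * y)%g >-> x * y}.
Proof.
move=> x y; apply/matrixP => i j; rewrite !mxE.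
rewrite (bigD1 (enum_rank (enum_val i * x)%g)) //= !mxE !enum_rankK eqxx mul1r mulgA.
rewrite big1 ?addr0 // => k nk; rewrite !mxE; case: eqP => [E|]; last by rewrite mul0r.
by rewrite E enum_valK eqxx in nk.
Qed.

(** On the span of the [regular_mx x], this entry is the coefficient of the identity. *)
Definition coef1 (M : 'M[K]_#|gT|) : K := M (enum_rank 1%g) (enum_rank 1%g).

Lemma coef1_regular x : coef1 (regular_mx x) = (x == 1%g)%:R.
Proof. by rewrite /coef1 mxE !enum_rankK mul1g. Qed.

End RegularRepresentation.

Lemma np_series_plcs (p : nat) (gT : finGroupType) (G : {group gT}) :
  prime p -> np_series p (plcs p G).
Proof.
move=> pp; split=> [i|i j|i x].
- exact/plcs_leS/prime_gt1.
- exact: plcs_comm.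
- exact: plcs_expp.
Qed.

Lemma mul3_sum (A : pzRingType) (J : finType) (b : J -> A) (c d f : J -> nat) :
  (\sum_j b j *+ c j) * (\sum_j b j *+ d j) * (\sum_j b j *+ f j) =
    \sum_i \sum_j \sum_k (b i * b j * b k) *+ (c i * d j * f k).
Proof.
rewrite !mulr_suml; apply: eq_bigr => i _.
rewrite [X in X * _]mulr_sumr !mulr_suml; apply: eq_bigr => j _.
rewrite mulr_sumr; apply: eq_bigr => k _.
by rewrite !(mulrnAl, mulrnAr) -!mulrnA; congr (_ *+ _); lia.
Qed.

Section GroupTensor.
Variables (R : comNzSemiRingType) (p : nat) (gT : finGroupType) (G : {group gT}).

(** [T] is the coefficient of the identity in a product of three Jennings monomials, and [e] gives
    the coordinates of group elements in these monomials. *)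
Lemma group_tensor : prime p -> pgroup p G ->
  exists (ws : seq nat) (J : finType) (_ : J) (wt : J -> nat)
    (e : gT -> J -> 'F_p) (T : J -> J -> J -> 'F_p),
  [/\ forall i, logn p #|plcs p G i| = count (leq i) ws,
      forall t : R, \sum_j t ^+ wt j = \prod_(w <- ws) \sum_(e < p) t ^+ (w * e),
      forall i j k, (p.-1 * sumn ws < wt i + wt j + wt k)%N -> T i j k = 0
    & forall x y z, x \in G -> y \in G -> z \in G ->
      \sum_i \sum_j \sum_k e x i * e y j * e z k * T i j k = (x * y * z == 1)%g%:R].
Proof.
move=> pp pG.
have [L1 _] := plengthP pp pG.
have charA : p%:R = 0 :> 'M['F_p]_#|gT|.
  apply/matrixP => i j; rewrite -mulr_natr mul1r.
  rewrite -(rmorph_nat (@scalar_mx _ _)) /=.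
  by rewrite pchar_Fp_0 // !mxE mul0rn.
have [ws [J [j0 [wt [b [h1 h2 h3 h4 h5]]]]]] := jennings pp charA
  (@regular_mx1 'F_p gT) (@regular_mxM 'F_p gT) R (np_series_plcs G pp) pG L1.
have span x : exists c : J -> nat, x \in G -> regular_mx 'F_p x = \sum_j b j *+ c j.
  case: (boolP (x \in G)) => [/h4[c Ec]|_]; [by exists c|by exists (fun=> 0%N)].
have [c cE] := boolp.choice span.
exists ws, J, j0, wt, (fun x j => (c x j)%:R), (fun i j k => coef1 (b i * b j * b k)).
split=> // [i j k lt|x y z xG yG zG].
  by rewrite (h5 _ _ (ifilM (ifilM (h3 i) (h3 j)) (h3 k)) lt) /coef1 mxE.
rewrite -coef1_regular !regular_mxM !cE //.
rewrite mul3_sum.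
rewrite /coef1 summxE; apply: eq_bigr => i _.
rewrite summxE; apply: eq_bigr => j _; rewrite summxE; apply: eq_bigr => k _.
by rewrite mulmxnE -!natrM mulr_natl.
Qed.

End GroupTensor.

Lemma sum_inj_le (R : numDomainType) (X J : finType) (D : {pred X}) (l : X -> J) (f : J -> R) :
  {in D &, injective l} -> (forall j, 0 <= f j) ->
  \sum_(x in D) f (l x) <= \sum_j f j.
Proof.
move=> linj f0; rewrite -(big_imset f linj) /= [leRHS](bigID (mem (l @: D))) /=.
by rewrite lerDl sumr_ge0.
Qed.

Lemma sum_nested_pair (R : nmodType) (I X Y : finType) (P : pred I) (A : I -> {set X})
    (B : I -> {set Y}) (f : I * X * Y -> R) :
  \sum_(i | P i) \sum_(x in A i) \sum_(y in B i) f (i, x, y) =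
  \sum_(a in [pred a | [&& P a.1.1, a.1.2 \in A a.1.1 & a.2 \in B a.1.1]]) f a.
Proof.
rewrite pair_big_dep pair_big_dep /=.
by apply: eq_big => -[[i x] y] //=; rewrite inE andbA.
Qed.

(** Summing the hypothesis over all triples repeats each pair once per element of the third set; the
    divisions by cardinals cancel these repetitions. *)
Lemma sum_cube (R : numFieldType) (X Y Z : finType) (S : {set X}) (T : {set Y}) (U : {set Z})
    (q1 : Z -> X -> R) (q2 : X -> Y -> R) (q3 : Y -> Z -> R) (m t : R) :
  (0 < #|S| * #|T| * #|U|)%N ->
  (forall s u v, s \in S -> u \in T -> v \in U ->
     t <= m * (q1 v s / #|T|%:R + q2 s u / #|U|%:R + q3 u v / #|S|%:R)) ->
  (#|S| * #|T| * #|U|)%:R * t <=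
    m * (\sum_(v in U) \sum_(s in S) q1 v s + \sum_(s in S) \sum_(u in T) q2 s u
         + \sum_(u in T) \sum_(v in U) q3 u v).
Proof.
rewrite !muln_gt0 => /andP[/andP[S0 T0] U0] le.
have -> : (#|S| * #|T| * #|U|)%:R * t = \sum_(s in S) \sum_(u in T) \sum_(v in U) t.
  by rewrite !sumr_const -!mulrnA mulr_natl; congr (_ *+ _); lia.
have avg (W : finType) (C : {set W}) (x : R) : (0 < #|C|)%N -> (x / #|C|%:R) *+ #|C| = x.
  by move=> C0; rewrite -mulr_natr divfK // pnatr_eq0 -lt0n.
have -> : \sum_(v in U) \sum_(s in S) q1 v s =
    \sum_(s in S) \sum_(u in T) \sum_(v in U) q1 v s / #|T|%:R.
  rewrite exchange_big; apply: eq_bigr => s _.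
  by rewrite sumr_const -mulr_suml avg.
have -> : \sum_(s in S) \sum_(u in T) q2 s u =
    \sum_(s in S) \sum_(u in T) \sum_(v in U) q2 s u / #|U|%:R.
  by apply: eq_bigr => s _; apply: eq_bigr => u _; rewrite sumr_const avg.
have -> : \sum_(u in T) \sum_(v in U) q3 u v =
    \sum_(s in S) \sum_(u in T) \sum_(v in U) q3 u v / #|S|%:R.
  rewrite sumr_const; under [in RHS]eq_bigr do rewrite -mulr_suml.
  by rewrite -mulr_suml avg.
rewrite -!big_split mulr_sumr; apply: ler_sum => s sS.
rewrite -!big_split mulr_sumr; apply: ler_sum => u uT.
rewrite -!big_split mulr_sumr; apply: ler_sum => v vU.
exact: le.
Qed.

Lemma lexi_inj (N a a' b b' : nat) : (b < N)%N -> (b' < N)%N ->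
  (N * a)%:Z - b%:Z = (N * a')%:Z - b'%:Z -> a = a' /\ b = b'.
Proof.
move=> bN b'N E.
have E' : (N * a + b' = N * a' + b)%N by lia.
have aa : a = a'.
  have := congr1 (divn^~ N) E'; rewrite !(mulnC N) !divnMDl ?(leq_ltn_trans _ bN) //.
  by rewrite !divn_small // !addn0.
by split=> //; move: E'; rewrite aa => /addnI.
Qed.

(** * The bound on an STPP construction by the generating function of the weights *)

Section STPPBound.
Variables (R : realType) (p : nat) (gT : finGroupType) (G : {group gT}).
Variables (I : finType) (S T U : I -> {set gT}).
Hypotheses (p_prime : prime p) (pG : pgroup p G) (stpp : STPP G S T U).

Lemma STPP_bound : exists ws : seq nat,
  (forall i, logn p #|plcs p G i| = count (leq i) ws) /\
  forall lam : R, 0 <= lam ->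
    (\sum_i (#|S i| * #|T i| * #|U i|)%:R `^ (2 / 3)) *
      expR (- (lam * (p.-1 * sumn ws)%:R / 3)) <=
    \prod_(w <- ws) \sum_(e < p) expR (- lam) ^+ (w * e).
Proof.
have [ws [J [j0 [wt [e [Tn [h1 h2 h3 h4]]]]]]] := group_tensor R p_prime pG.
exists ws; split=> // lam lam0; rewrite -h2.
have [sub _ STPP2] := stpp.
(* Completing a variable to a supported triple needs all three sets nonempty; the other indices
   contribute 0 to the sum. *)
pose ok i := [&& S i != finset.set0, T i != finset.set0 & U i != finset.set0].
pose XT := (I * gT * gT)%type.
(* The variables stand for u' s^-1, s' t^-1 and t' u^-1, so that their product is a conjugate of the
   word in the simultaneous triple product property. *)
pose DX : pred XT := [pred a | [&& ok a.1.1, a.1.2 \in U a.1.1 & a.2 \in S a.1.1]].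
pose DY : pred XT := [pred a | [&& ok a.1.1, a.1.2 \in S a.1.1 & a.2 \in T a.1.1]].
pose DZ : pred XT := [pred a | [&& ok a.1.1, a.1.2 \in T a.1.1 & a.2 \in U a.1.1]].
pose quot (a : XT) := (a.1.2 * a.2^-1)%g.
pose Phi (x y z : XT) := [&& x.1.1 == y.1.1, y.1.1 == z.1.1,
  x.2 == y.1.2, y.2 == z.1.2 & z.2 == x.1.2].
pose r (i : I) (g : gT) : nat := enum_rank (i, g).
have r_inj i g i' g' : r i g = r i' g' -> i = i' /\ g = g'.
  by move=> /val_inj/enum_rank_inj[-> ->].
pose N := #|{: I * gT}|.
have rN i g : (r i g < N)%N by apply: ltn_ord.
(* Integer ranks summing to 0 on the support, injective on each factor: the
   support of a direct sum of matrix multiplication tensors is tight. *)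
pose aX (a : XT) : int := (N * r a.1.1 a.1.2)%:Z - (r a.1.1 a.2)%:Z.
pose aY (a : XT) : int := (r a.1.1 a.1.2)%:Z - (N * (N * r a.1.1 a.2))%:Z.
pose aZ (a : XT) : int := (N * (N * r a.1.1 a.1.2))%:Z - (N * r a.1.1 a.2)%:Z.
have inG i g : (g \in S i) || (g \in T i) || (g \in U i) -> g \in G.
  by have [sS sT sU] := sub i; case/orP=> [/orP[]|]; apply: fintype.subsetP.
have PhiE x y z : x \in DX -> y \in DY -> z \in DZ ->
    (quot x * quot y * quot z == 1)%g = Phi x y z.
  case: x y z => [[i u'] s] [[j s'] t] [[k t'] u] /=.
  move=> /and3P[/= _ uU sS] /and3P[/= _ sS' tT] /and3P[/= _ tT' uU'].
  rewrite /quot /Phi /=; apply/eqP/and5P.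
    move=> E; have E' : (s^-1 * s' * t^-1 * t' * u^-1 * u' = 1)%g.
      have : (u' * (s^-1 * s' * t^-1 * t' * u^-1) = 1)%g by rewrite -[RHS]E !mulgA.
      by move=> /(congr1 (mulg u'^-1))%g; rewrite mulKg mulg1 => ->; rewrite mulVg.
    have [ij jk] := STPP2 i j k _ _ _ _ _ _ sS sS' tT tT' uU' uU E'.
    move: sS' tT tT' uU' E'; rewrite -jk -ij => sS' tT tT' uU' E'.
    by have [_ tpp _] := stpp; have [-> -> ->] := tpp i _ _ _ _ _ _ sS sS' tT tT' uU' uU E'.
  by move=> [_ _ /eqP-> /eqP-> /eqP->]; rewrite !mulgA mulgKV mulgKV mulgV.
have quotG x : x \in DX \/ x \in DY \/ x \in DZ -> quot x \in G.
  case: x => [[i g] h]; rewrite /quot /= !inE /=.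
  by case=> [|[]] /and3P[_ gi hi]; rewrite groupM ?groupV ?(inG i) ?gi ?hi ?orbT.
have [lX [lY [lZ [iX iY iZ lw]]]] : exists (lX lY lZ : XT -> J),
  [/\ {in DX &, injective lX}, {in DY &, injective lY}, {in DZ &, injective lZ}
    & forall x y z, x \in DX -> y \in DY -> z \in DZ -> Phi x y z ->
        (wt (lX x) + wt (lY y) + wt (lZ z) <= p.-1 * sumn ws)%N].
  have N0 i (g : gT) : (0 < N)%N := leq_ltn_trans (leq0n _) (rN i g).
  apply: (@tight_tensor_leads _ J j0 wt _ _ _ _ DX DY DZ (e \o quot) (e \o quot)
    (e \o quot) Tn Phi aX aY aZ h3).
  - by move=> x y z xD yD zD; rewrite -PhiE // -h4 ?quotG; auto.
  - move=> [[i g] h] [[i' g'] h'] _ _; rewrite /aX /= => /(lexi_inj (rN _ _) (rN _ _))[].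
    by move=> /r_inj[-> ->] /r_inj[_ ->].
  - move=> [[i g] h] [[i' g'] h'] _ _ /= /(congr1 (fun z => - z)).
    rewrite /aY !opprB /= => /(lexi_inj (rN _ _) (rN _ _))[] E /r_inj[-> ->].
    by move/eqP: E; rewrite eqn_pmul2l ?(N0 i g) // => /eqP/r_inj[_ ->].
  - move=> [[i g] h] [[i' g'] h'] _ _; rewrite /aZ /= => E.
    have {}E : ((N * r i g)%:Z - (r i h)%:Z = (N * r i' g')%:Z - (r i' h')%:Z).
      have N0' : N%:Z != 0 by have := N0 i g; lia.
      by apply: (mulfI N0'); rewrite !mulrBr -!PoszM.
    by have [/r_inj[-> ->] /r_inj[_ ->]] := lexi_inj (rN _ _) (rN _ _) E.
  - move=> [[i u'] s] [[j s'] t] [[k t'] u] _ _ _ /and5P[/= /eqP-> /eqP-> /eqP-> /eqP-> /eqP->].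
    by rewrite /aX /aY /aZ /=; lia.
  - move=> [[i u] s] /and3P[/= oki uU sS]; have /and3P[_ /finset.set0Pn[t tT] _] := oki.
    exists (i, s, t), (i, t, u); rewrite /Phi /= !eqxx; split=> //; exact/and3P.
  - move=> [[i s] t] /and3P[/= oki sS tT]; have /and3P[_ _ /finset.set0Pn[u uU]] := oki.
    exists (i, u, s), (i, t, u); rewrite /Phi /= !eqxx; split=> //; exact/and3P.
  - move=> [[i t] u] /and3P[/= oki tT uU]; have /and3P[/finset.set0Pn[s sS] _ _] := oki.
    exists (i, u, s), (i, s, t); rewrite /Phi /= !eqxx; split=> //; exact/and3P.
set t := expR (- lam); set P := \sum_j t ^+ wt j.
have q0 j : 0 <= t ^+ wt j by rewrite exprn_ge0 ?expR_ge0.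
pose q (l : XT -> J) i g h : R := t ^+ wt (l (i, g, h)).
have Qle (l : XT -> J) (A B : I -> {set gT}) :
    {in [pred a : XT | [&& ok a.1.1, a.1.2 \in A a.1.1 & a.2 \in B a.1.1]] &, injective l} ->
    \sum_(i | ok i) \sum_(g in A i) \sum_(h in B i) q l i g h <= P.
  move=> li; rewrite (sum_nested_pair _ _ _ (fun a => t ^+ wt (l a))).
  exact: (sum_inj_le li q0).
set tau := expR (- (_ / 3)).
rewrite mulr_suml (bigID ok) /= [X in _ + X]big1 ?addr0; last first.
  move=> i nok; have -> : (#|S i| * #|T i| * #|U i|)%N = 0%N.
    apply/eqP; rewrite !muln_eq0 !cards_eq0 -orbA.
    by move: nok; rewrite /ok !negb_and !negbK.
  by rewrite powR0 ?mul0r // gt_eqF // divr_gt0.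
apply: (@le_trans _ _ (\sum_(i | ok i) 3^-1 *
   (\sum_(g in U i) \sum_(h in S i) q lX i g h + \sum_(g in S i) \sum_(h in T i) q lY i g h
    + \sum_(g in T i) \sum_(h in U i) q lZ i g h))); last first.
  rewrite -mulr_sumr !big_split /= mulrC ler_pdivrMr //.
  have := Qle lX U S iX; have := Qle lY S T iY; have := Qle lZ T U iZ; lra.
apply: ler_sum => i oki; have /and3P[S0 T0 U0] := oki.
set n := (#|S i| * #|T i| * #|U i|)%N.
have [cS cT cU] : [/\ 0 < #|S i|, 0 < #|T i| & 0 < #|U i|]%N by rewrite !card_gt0.
have n0 : (0 < n)%N by rewrite !muln_gt0 cS cT.
have nR : 0 < n%:R :> R by rewrite ltr0n.
have m0 : 0 < n%:R `^ (1 / 3) :> R by rewrite powR_gt0.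
(* The extra factor n^(1/3) turns n^(2/3) into n, the number of triples (s, g, h). In the AM-GM step
   for each triple, it cancels against the cube root of the product of the three cardinals. *)
rewrite -(ler_pM2l m0) !mulrA -powRD; last by rewrite gt_eqF ?implybT.
have -> : 1 / 3 + 2 / 3 = 1 :> R by field.
rewrite powRr1 ?ler0n //; apply: sum_cube => // s g h sS gT' hU.
have lwi : (wt (lX (i, h, s)) + wt (lY (i, s, g)) + wt (lZ (i, g, h)) <= p.-1 * sumn ws)%N.
  by apply: lw; rewrite ?inE /= ?oki ?hU ?sS ?gT' // /Phi /= !eqxx.
rewrite /q; move: lwi; set w1 := wt _; set w2 := wt _; set w3 := wt _ => lwi.
have tE (w k : nat) : (0 < k)%N -> t ^+ w / k%:R = expR (- (lam * w%:R) - ln k%:R).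
  move=> k0; rewrite expRD [expR (- ln _)]expRN lnK ?posrE ?ltr0n // -expRM_natl.
  by congr (expR _ / _); rewrite mulrN mulrC.
rewrite !tE //; apply: le_trans (ler_wpM2l _ (amgm3 _ _ _)); last first.
  by rewrite divr_ge0 // ltW.
rewrite /powR (gt_eqF nR) mulrA divfK // -expRD ler_expR.
have -> : ln n%:R = ln #|S i|%:R + ln #|T i|%:R + ln #|U i|%:R :> R.
  by rewrite !natrM !lnM ?posrE ?mulr_gt0 ?ltr0n.
have : lam * (w1 + w2 + w3)%:R <= lam * (p.-1 * sumn ws)%:R.
  by rewrite ler_wpM2l // ler_nat.
rewrite !natrD; lra.
Qed.

End STPPBound.

(** * Moments of the p-degrees *)

Lemma count_leq_split (ws : seq nat) i :
  count (leq i) ws = (count_mem i ws + count (leq i.+1) ws)%N.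
Proof.
rewrite -count_predUI (@eq_count _ (predI _ _) pred0) ?count_pred0 ?addn0.
  by apply: eq_count => w /=; rewrite leq_eqVlt eq_sym.
by move=> w /=; case: eqP => // ->; rewrite ltnn.
Qed.

Section DegreeMoments.
Variables (R : realType) (p : nat) (gT : finGroupType) (G : {group gT}) (ws : seq nat).
Hypotheses (p_prime : prime p) (pG : pgroup p G).
Hypothesis wsE : forall i, logn p #|plcs p G i| = count (leq i) ws.

Lemma size_weights : size ws = logn p #|G|.
Proof. by rewrite -[G]/(plcs p G 0) wsE -count_predT; apply: eq_count. Qed.

Lemma size_pdegrees : size (pdegrees p G) = plength p G.
Proof. exact: size_mkseq. Qed.

(** Weight 0 does not occur because [plcs p G 0] and [plcs p G 1] are both G; weights above the
    length do not occur because the series has become trivial. *)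
Lemma weights_bounds w : w \in ws -> (0 < w <= plength p G)%N.
Proof.
move=> wws; have [E _] := plengthP p_prime pG.
have : count (leq 1) ws == size ws by rewrite size_weights -wsE.
rewrite -all_count => /allP/(_ _ wws)-> /=; rewrite leqNgt; apply/negP => lw.
have := wsE (plength p G).+1; rewrite E cards1 logn1 => /esym/eqP.
by rewrite -leqn0 leqNgt -has_count => /hasP[]; exists w.
Qed.

Lemma nth_pdegrees j : (j < plength p G)%N ->
  nth 0%N (pdegrees p G) j = count_mem j.+1 ws.
Proof.
move=> lt; rewrite nth_mkseq // card_quotient; last first.
  exact: fintype.subset_trans (plcs_sub _ p_prime _) (plcs_norm _ p_prime _).
rewrite -divgS ?plcs_leS ?prime_gt1 // logn_div ?cardSg ?plcs_leS ?prime_gt1 //.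
by rewrite !wsE count_leq_split addnK.
Qed.

(** This identifies X_r with a uniformly chosen entry of [ws], so its moments are A / n and B /
    n. *)
Lemma sum_weights (h : nat -> R) :
  \sum_(w <- ws) h w =
  \sum_(j < size (pdegrees p G)) h j.+1 * (nth 0%N (pdegrees p G) j)%:R.
Proof.
rewrite size_pdegrees.
transitivity (\sum_(j < plength p G) \sum_(w <- ws) h j.+1 * (w == j.+1)%:R).
  rewrite exchange_big; apply: eq_big_seq => w /weights_bounds/andP[w0 wl].
  have lt : (w.-1 < plength p G)%N by rewrite prednK.
  rewrite (bigD1 (Ordinal lt)) //= prednK // eqxx mulr1 big1 ?addr0 // => j nj.
  case: eqP => [E|_]; last by rewrite mulr0.
  by move: nj; rewrite -val_eqE /= E eqxx.
apply: eq_bigr => j _; rewrite -mulr_sumr nth_pdegrees // -sum1_count natr_sum.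
congr (_ * _); rewrite [RHS]big_mkcond; apply: eq_bigr => w _ /=.
by case: eqP.
Qed.

Let n : R := (size ws)%:R.
Let A : R := \sum_(w <- ws) w%:R.
Let B : R := \sum_(w <- ws) w%:R ^+ 2.

Lemma size_le_sum_weights : n <= A.
Proof.
rewrite /n /A -sum1_size natr_sum !big_seq; apply: ler_sum => w /weights_bounds/andP[w0 _].
by rewrite ler_nat.
Qed.

Lemma sum_sqr_weights_gt0 : (0 < size ws)%N -> 0 < B.
Proof.
move=> n0; apply: (@lt_le_trans _ _ n); first by rewrite ltr0n.
rewrite /n /B -sum1_size natr_sum !big_seq; apply: ler_sum => w /weights_bounds/andP[w0 _].
by rewrite -natrX ler_nat expn_gt0 w0.
Qed.

Lemma sumn_pdegreesE : sumn (pdegrees p G) = size ws.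
Proof. by rewrite sumn_pdegrees // size_weights. Qed.

(** The variance is B / n - (A / n)^2, so n B <= M n^2 + A^2, and n <= A because all weights are at
    least 1. *)
Lemma variance_bound (M : R) : (0 < size ws)%N -> 0 <= M ->
  (variance (degree_law R (pdegrees p G)) (degree_rv R) <= M%:E)%E ->
  n * B <= (M + 1) * A ^+ 2.
Proof.
move=> n0 M0; rewrite degree_variance ?sumn_pdegreesE // lee_fin.
have nR : 0 < n by rewrite ltr0n.
set mu := \sum_(j < _) j.+1%:R * _ => le.
have muE : mu = A / n.
  rewrite /A (sum_weights (fun w => w%:R)) mulr_suml; apply: eq_bigr => j _.
  by rewrite mulrA.
have VE : \sum_(w <- ws) (w%:R - mu) ^+ 2 <= M * n.
  rewrite (sum_weights (fun w => (w%:R - mu) ^+ 2)) -ler_pdivrMr //.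
  apply: le_trans le; rewrite mulr_suml le_eqVlt; apply/orP; left; apply/eqP.
  by apply: eq_bigr => j _; rewrite mulrA.
have E : \sum_(w <- ws) (w%:R - mu) ^+ 2 = B - A ^+ 2 / n.
  have -> : \sum_(w <- ws) (w%:R - mu) ^+ 2 =
      \sum_(w <- ws) (w%:R ^+ 2 - 2 * mu * w%:R + mu ^+ 2).
    by apply: eq_bigr => w _; ring.
  rewrite big_split /= sumrB -mulr_sumr -/A -/B.
  rewrite big_const_seq count_predT iter_addr_0 -mulr_natr -/n muE.
  by field; rewrite gt_eqF.
have nA : n ^+ 2 <= A ^+ 2.
  by rewrite ler_sqr ?nnegrE ?(ltW nR) ?size_le_sum_weights //
    (le_trans (ltW nR)) ?size_le_sum_weights.
move: VE; rewrite E lerBlDr => BE.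
have := ler_wpM2l (ltW nR) BE.
have -> : n * (M * n + A ^+ 2 / n) = M * n ^+ 2 + A ^+ 2 by field; rewrite gt_eqF.
move=> /le_trans; apply; rewrite mulrDl mul1r lerD2r.
exact: ler_wpM2l.
Qed.

(** With l the length, all weights are at most l, so B <= l^2 n, while the hypothesis reads l n <= c
    A. *)
Lemma expectation_bound (c : R) : (0 < size ws)%N -> 0 < c ->
  (((plength p G)%:R / c)%:E <= expectation (degree_law R (pdegrees p G)) (degree_rv R))%E ->
  n * B <= c ^+ 2 * A ^+ 2.
Proof.
move=> n0 c0; rewrite degree_expectation ?sumn_pdegreesE // lee_fin.
have nR : 0 < n by rewrite ltr0n.
set mu := \sum_(j < _) j.+1%:R * _ => le.
have muE : mu = A / n.
  rewrite /A (sum_weights (fun w => w%:R)) mulr_suml; apply: eq_bigr => j _.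
  by rewrite mulrA.
set l : R := (plength p G)%:R in le.
have BE : B <= l ^+ 2 * n.
  rewrite /B /n -sum1_size natr_sum mulr_sumr !big_seq.
  apply: ler_sum => w /weights_bounds/andP[_ wl].
  by rewrite mulr1 ler_sqr ?nnegrE ?ler0n // ler_nat.
have lE : l * n <= c * A.
  by move: le; rewrite muE ler_pdivrMr // mulrAC ler_pdivlMr // [A * c]mulrC.
apply: le_trans (ler_wpM2l (ltW nR) BE) _.
have -> : n * (l ^+ 2 * n) = (l * n) ^+ 2 by ring.
rewrite -exprMn ler_sqr ?nnegrE ?mulr_ge0 ?ler0n //; first exact: ltW.
by apply: le_trans (ltW nR) size_le_sum_weights.
Qed.

End DegreeMoments.

(** * From a power saving in the order of the group to an exponent above 2 *)

Lemma irr_dim_powR_sum (R : realType) (gT : finGroupType) (G : {group gT}) (tau : R) :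
  2 <= tau -> #|G|%:R <= \sum_(j : Iirr G) (irr_dim j)%:R `^ tau.
Proof.
move=> tau2.
have -> : #|G| = (\sum_(j : Iirr G) irr_dim j ^ 2)%N.
  apply/eqP; rewrite -(@eqr_nat algC) -irr_sum_square natr_sum; apply/eqP.
  by apply: eq_bigr => j _; rewrite natrX irr1_degree.
rewrite natr_sum; apply: ler_sum => j _.
have d1 : 1 <= (irr_dim j)%:R :> R by rewrite ler1n irr_degree_gt0.
rewrite natrX -powR_mulrn ?(le_trans _ d1) //.
by apply: ler_powR.
Qed.

(** Used with N = |G| and k = |S_i| |T_i| |U_i|: raising the exponent from 2 to 2 + eps costs at
    most a factor |G|^eps. *)
Lemma powR_excess (R : realType) (k N : nat) (eps : R) : 0 <= eps -> (0 < N)%N -> (k <= N ^ 3)%N ->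
  k%:R `^ ((2 + eps) / 3) <= k%:R `^ (2 / 3) * N%:R `^ eps :> R.
Proof.
move=> eps0 N0 kN; have [->|k0] := posnP k.
  by rewrite powR0 ?mulr_ge0 ?powR_ge0 // gt_eqF // divr_gt0 //; lra.
have kR : 0 < k%:R :> R by rewrite ltr0n.
rewrite mulrDl powRD; last by rewrite (gt_eqF kR) implybT.
rewrite ler_pM2l ?powR_gt0 //.
have -> : N%:R `^ eps = ((N ^ 3)%N%:R : R) `^ (eps / 3).
  by rewrite natrX -powR_mulrn // -powRrM mulrC divfK.
apply: ge0_ler_powR; rewrite ?nnegrE ?ler0n ?ler_nat //.
by rewrite divr_ge0.
Qed.

Theorem theorem3p8 (R : realType)
    (GG : forall gT : finGroupType, {group gT} -> Prop)
    (m : nat)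
    (exponent_le : forall (gT : finGroupType) (G : {group gT}),
       GG gT G -> (exponent G <= m)%N)
    (pgroupGG : forall (gT : finGroupType) (G : {group gT}),
       GG gT G -> exists p : nat, prime p /\ pgroup p G)
    (hyp :
      (exists M : R, forall (gT : finGroupType) (G : {group gT}) (p : nat),
         GG gT G -> prime p -> pgroup p G -> G :!=: 1%g ->
         (variance (degree_law R (pdegrees p G)) (degree_rv R) <= M%:E)%E)
      \/
      (exists c : R, 0 < c /\
        forall (gT : finGroupType) (G : {group gT}) (p : nat),
         GG gT G -> prime p -> pgroup p G -> G :!=: 1%g ->
         (((plength p G)%:R / c)%:E
            <= expectation (degree_law R (pdegrees p G)) (degree_rv R))%E)) :
  exists tau : R, 2 < tau /\ tau <= 3 /\
    forall (gT : finGroupType) (G : {group gT}), GG gT G ->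
    forall (I : finType) (S T U : I -> {set gT}), STPP G S T U ->
      \sum_(i : I) (#|S i| * #|T i| * #|U i|)%:R `^ (tau / 3)
        <= \sum_(j : Iirr G) (irr_dim j)%:R `^ tau.
Proof.
have [kap kap0 kapP] : exists2 kap : R, 0 < kap &
    forall (gT : finGroupType) (G : {group gT}) (p : nat) (ws : seq nat),
      GG gT G -> prime p -> pgroup p G ->
      (forall i, logn p #|plcs p G i| = count (leq i) ws) -> (0 < size ws)%N ->
      kap * (size ws)%:R * \sum_(w <- ws) w%:R ^+ 2 <= (\sum_(w <- ws) w%:R) ^+ 2.
  have nt (gT : finGroupType) (G : {group gT}) (p : nat) (ws : seq nat) :
      (forall i, logn p #|plcs p G i| = count (leq i) ws) -> (0 < size ws)%N -> G :!=: 1%g.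
    move=> wsE n0; apply/eqP => G1; move: n0.
    by rewrite (size_weights wsE) G1 cards1 logn1.
  case: hyp => [[M hM]|[c [c0 hc]]].
    (* The maximum with 0 is taken because M is not assumed nonnegative. *)
    have M1 : 0 < Num.max M 0 + 1 by rewrite ltr_pwDr // le_max lexx orbT.
    exists (Num.max M 0 + 1)^-1; first by rewrite invr_gt0.
    move=> gT G p ws GGG pp pG wsE n0; rewrite -mulrA ler_pdivrMl //.
    apply: (variance_bound pp pG wsE n0); first by rewrite le_max lexx orbT.
    apply: le_trans (hM _ _ _ GGG pp pG (nt _ _ _ _ wsE n0)) _.
    by rewrite lee_fin le_max lexx.
  exists (c ^+ 2)^-1; first by rewrite invr_gt0 exprn_gt0.
  move=> gT G p ws GGG pp pG wsE n0; rewrite -mulrA ler_pdivrMl ?exprn_gt0 //.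
  exact: (expectation_bound pp pG wsE n0 c0 (hc _ _ _ GGG pp pG (nt _ _ _ _ wsE n0))).
have lnm : 0 < ln (m.+2%:R : R) by rewrite ln_gt0 // ltr1n.
(* The bound 1 keeps tau <= 3; the other makes |G|^eps at most exp (kap n / 36), as p <= m + 2. The
   shift by 2 makes the logarithm positive for every m. *)
pose eps := Num.min 1 (kap / 36 / ln m.+2%:R).
have eps0 : 0 < eps by rewrite lt_min ltr01 !divr_gt0.
have eps1 : eps <= 1 by rewrite ge_min lexx.
have epsm : eps * ln m.+2%:R <= kap / 36 by rewrite -ler_pdivlMr // ge_min lexx orbT.
exists (2 + eps); split; first lra; split; first lra.
move=> gT G GGG I S T U stpp; have [p [pp pG]] := pgroupGG _ _ GGG.
have p0 := prime_gt0 pp.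
apply: le_trans (irr_dim_powR_sum G _); last by lra.
have [ws [wsE bound]] := STPP_bound R pp pG stpp.
have cG : #|G| = (p ^ size ws)%N by rewrite (size_weights wsE); apply: card_pgroup.
have [sub _ _] := stpp.
apply: (@le_trans _ _ ((\sum_i (#|S i| * #|T i| * #|U i|)%:R `^ (2 / 3)) * #|G|%:R `^ eps)).
  rewrite mulr_suml; apply: ler_sum => i _; apply: powR_excess; [exact: ltW|exact: cardG_gt0|].
  have [sS sT sU] := sub i.
  by rewrite !expnS expn0 muln1 mulnA !leq_mul ?subset_leq_card.
have cG0 : 0 < #|G|%:R :> R by rewrite ltr0n cardG_gt0.
have pR : 0 < p%:R :> R by rewrite ltr0n.
(* For the trivial group the bound at lam = 0 already gives a sum of at most 1. *)
have [n0|n0] := posnP (size ws).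
  have := bound 0 (lexx _); rewrite (size0nil n0) big_nil mul0r mul0r oppr0 expR0 mulr1.
  by rewrite cG n0 expn0 powR1 mulr1.
have B0 := sum_sqr_weights_gt0 R pp pG wsE n0.
have [lam lam0 le] := prod_geometric_le (prime_gt1 pp) (ltW kap0) B0
  (kapP _ _ _ _ GGG pp pG wsE n0).
have := le_trans (bound lam lam0) le; rewrite ler_pM2r ?expR_gt0 // => {}le.
apply: le_trans (ler_wpM2r (powR_ge0 _ _) le) _.
rewrite -natrX -cG -[leLHS]mulrA -[leRHS]mulr1 ler_pM2l //.
rewrite /powR gt_eqF // -expRD expR_le1 cG natrX lnXn // -mulr_natl.
have pm : (p <= m.+2)%N.
  (* For a nontrivial p-group the prime p divides the exponent, so p is bounded over the family. *)
  have : p \in \pi(exponent G).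
    by rewrite pi_of_exponent mem_primes pp cardG_gt0 /= cG dvdn_exp.
  rewrite mem_primes => /and3P[_ e0 /(dvdn_leq e0) le_pe].
  by apply: leq_trans le_pe _; apply: leq_trans (exponent_le _ _ GGG) _; lia.
have : ln p%:R <= ln m.+2%:R :> R by rewrite ler_ln ?posrE ?ltr0n // ler_nat.
have nR : 0 <= (size ws)%:R :> R by [].
move=> lnp.
have : eps * ln p%:R <= kap / 36 by apply: le_trans epsm; rewrite ler_pM2l.
by move=> /(ler_wpM2l nR); lra.
Qed.
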